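(* Let $\{S(t): t\ge 0\}$ be a semigroup on a nonempty subset $V$ of a normed space $(X,\|\cdot\|_X)$ over $\mathbb{K}\in\{\mathbb{R},\mathbb{C}\}$. If the semigroup is of Ladyzhenskaya type on a subset $B$ of $V$ at time $T>0$ with parameters $(n,\eta,\kappa)$ (with associated subspace $X_n$ and map $P:V\to X_n$), then it satisfies (i) the smoothing property (into an auxiliary space $Z$) on $B$ at time $T$ with parameters $(\eta,\kappa)$ and $$C(T)=(I-P)S(T),\quad M(T)=PS(T),\quad Z=X_n,$$ (ii) the generalized squeezing property on $B$ at time $T$ with parameters $(n,\eta,1,\kappa)$. Moreover, if $B$ is a nonempty bounded subset of $V$ such that $S(T)B\subseteq B$ and $\sigma\in(0,1-\eta)$, then there exist $k_0\in\mathbb{N}$, $a,b>0$ and $h\ge1$ such that the covering condition $$N^{V}(S(kT)B,aq^{k})\le b h^{k},\quad k\in\mathbb{N},\ k\ge k_0,$$ holds with $q=\eta+\sigma$ and $$h\le\left(1+\tfrac{2\kappa\, d_{BM}(X_n,\ell^n_2)}{\sigma}\right)^{\mathbf{n}},$$ where $\mathbf{n}=n$ if $\mathbb{K}=\mathbb{R}$ and $\mathbf{n}=2n$ if $\mathbb{K}=\mathbb{C}$. Consequently, if $\{S(t): t\ge 0\}$ is a semigroup on a nonempty closed subset $V$ of a Banach space $X$ over $\mathbb{K}$ with a bounded absorbing set $\mathbf{B}\subseteq V$, the semigroup is of Ladyzhenskaya type on $\mathbf{B}$ at time $T$ with parameters $(n,\eta,\kappa)$, and the semigroup is asymptotically closed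 or $\mathbf{B}$ is closed, then for any $\sigma\in(0,1-\eta)$ there exists a $T$-discrete exponential attractor $\mathbf{M_0}$ for the semigroup and $$\dim_f^{V}(\mathbf{M_0})\le\mathbf{n}\log_{\frac{1}{\eta+\sigma}}\left(1+\tfrac{2\kappa\, d_{BM}(X_n,\ell^n_2)}{\sigma}\right).$$
   Context: $\mathbb{N}=\{1,2,\dots\}$. $V$ carries the metric $d(x,y)=\|x-y\|_X$. A semigroup $\{S(t):t\ge0\}$ on $V$ is a family of (not necessarily linear) maps $S(t):V\to V$ with $S(t)S(s)=S(t+s)$ for $t,s\ge 0$ and $S(0)=I$; ''$t\ge 0$'' means throughout either $t\in[0,\infty)$ or $t\in\mathbb{N}\cup\{0\}$ (and $T$ belongs to the time set). Ladyzhenskaya type on $B\subseteq V$ at time $T>0$ with parameters $(n,\eta,\kappa)$: there exist a linear subspace $X_n$ of $X$ of dimension $n\in\mathbb{N}$ (with the norm $\|\cdot\|_{X_n}=\|\cdot\|_X$), a map $P:V\to X_n$ and constants $\eta\in[0,1)$, $\kappa>0$ such that for all $x,y\in B$ $$\|(I-P)S(T)x-(I-P)S(T)y\|_X\le\eta\|x-y\|_X,\qquad\|PS(T)x-PS(T)y\|_X\le\kappa\|x-y\|_X.$$ Smoothing property (into an auxiliary space $Z$) on $B$ at time $T$ with parameters $(\eta,\kappa)$: $S(T)=C(T)+M(T)$ on $B$, where $\|C(T)x-C(T)y\|_X\le\eta\|x-y\|_X$ for $x,y\in B$ with $\eta\in[0,1)$, $M(T):B\to Z$ with $Z$ a normed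 space compactly embedded into $X$, and $\|M(T)x-M(T)y\|_Z\le\kappa\|x-y\|_X$ for $x,y\in B$ with $\kappa>0$. Generalized squeezing property on $B$ at time $T$ with parameters $(n,\eta,\mu,\kappa)$: there exist a map $P:V\to X_n$ with values in a normed space $(X_n,\|\cdot\|_{X_n})$ of dimension $n\in\mathbb{N}$ and constants $\eta\in[0,1)$, $\mu>0$, $\kappa>0$ such that for all $x,y\in B$: $\|S(T)x-S(T)y\|_X\le\eta\|x-y\|_X+\mu\|PS(T)x-PS(T)y\|_{X_n}$ and $\|PS(T)x-PS(T)y\|_{X_n}\le\kappa\|x-y\|_X$. $\ell_2^n$ is $\mathbb{K}^n$ with the Euclidean norm, and $d_{BM}(X_n,\ell^n_2)=\inf\{\|\Lambda\|_{\mathcal{L}(X_n,\ell^n_2)}\|\Lambda^{-1}\|_{\mathcal{L}(\ell^n_2,X_n)}:\Lambda:X_n\to\ell^n_2\text{ a linear isomorphism}\}$. Asymptotically closed: for any $t\ge 0$, $t_k\ge 0$ with $t_k\to\infty$ and any bounded sequence $x_k\in V$, if $S(t_k)x_k\to x$ and $S(t+t_k)x_k\to y$ with $x,y\in V$, then $S(t)x=y$. Absorbing set: $\mathbf{B}\subseteq V$ such that for every bounded $G\subseteq V$ there is $t_G\ge 0$ with $S(t)G\subseteq\mathbf{B}$ for all $t\ge t_G$. $\mathrm{dist}^V(G,H)=\sup_{x\in G}\inf_{y\in H}d(x,y)$. $N^V(G,\varepsilon)$ is the minimal number of open $\varepsilon$-balls in $V$ centered at points of $G$ needed to cover $G$;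 $\dim_f^V(G)=\limsup_{\varepsilon\to0^+}\log_{1/\varepsilon}N^V(G,\varepsilon)$. $T$-discrete exponential attractor: a nonempty compact set $\mathbf{M_0}\subseteq V$ such that $S(T)\mathbf{M_0}\subseteq\mathbf{M_0}$, $\dim_f^V(\mathbf{M_0})<\infty$, and there is $\xi>0$ with $\lim_{t\to\infty}e^{\xi t}\mathrm{dist}^V(S(t)G,\mathbf{M_0})=0$ for every bounded $G\subseteq V$. *)

(* Defs.v *)
From HB Require Import structures.
From mathcomp Require Import all_boot all_order all_algebra.
From mathcomp Require Import all_classical all_reals all_analysis.
From mathcomp Require Import complex.

Set Implicit Arguments.
Unset Strict Implicit.
Unset Printing Implicit Defensive.

Import Order.TTheory GRing.Theory Num.Theory.
Import numFieldNormedType.Exports.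

Local Open Scope classical_set_scope.
Local Open Scope ring_scope.

Inductive scalar_kind : Type := RealScalars | ComplexScalars.

Definition scalars (R : realType) (k : scalar_kind) : numFieldType :=
  match k with
  | RealScalars => R : numFieldType
  | ComplexScalars => complex R : numFieldType
  end.

Definition scalar_re (R : realType) (k : scalar_kind) : scalars R k -> R :=
  match k return scalars R k -> R with
  | RealScalars => fun x => x
  | ComplexScalars => fun z => complex.Re z
  end.

Definition real_dim (k : scalar_kind) (n : nat) : nat :=
  match k with RealScalars => n | ComplexScalars => (2 * n)%N end.

Inductive time_kind : Type := ContinuousTime | DiscreteTime.

Definition time_set (R : realType) (tk : time_kind) : set R :=
  match tk with
  | ContinuousTime => [set t : R | 0 <= t]
  | DiscreteTime => range (fun m : nat => m%:R : R)
  end.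

(* In a [normedModType K] the norm takes its values in [K], also for complex
   [K]; those values are nonnegative reals, so the real part loses nothing. *)
Definition rnorm (R : realType) (k : scalar_kind)
  (E : normedModType (scalars R k)) (x : E) : R := scalar_re `|x|.

Definition subspace_type (K : numFieldType) (X : normedModType K)
  (W : submodClosed X) : Type := {x : X | x \in W}.

Section SubspaceType.
Context (K : numFieldType) (X : normedModType K) (W : submodClosed X).
Local Notation sW := (subspace_type W).

HB.instance Definition _ := SubChoice.on sW.
HB.instance Definition _ := [SubChoice_isSubLmodule of sW by <:].

Let norm_sub (x : sW) : K := `|val x|.

Let norm_subD (x y : sW) : norm_sub (x + y) <= norm_sub x + norm_sub y.
Proof. by rewrite /norm_sub raddfD ler_normD. Qed.

Let norm_subZ (l : K) (x : sW) : norm_sub (l *: x) = `|l| * norm_sub x.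
Proof. by rewrite /norm_sub linearZ normrZ. Qed.

Let norm_sub_eq0 (x : sW) : norm_sub x = 0 -> x = 0.
Proof. by move=> /normr0_eq0 x0; apply: val_inj; rewrite x0 raddf0. Qed.

HB.instance Definition _ :=
  Lmodule_isNormed.Build K sW norm_subD norm_subZ norm_sub_eq0.

Definition subspace_incl : {linear sW -> X} := val.

End SubspaceType.

Definition has_dimension (K : numFieldType) (E : lmodType K) (n : nat) : Prop :=
  exists e : 'I_n -> E,
    bijective (fun c : 'rV[K]_n => \sum_(i < n) c 0 i *: e i).

Section BanachMazur.
Context (R : realType) (k : scalar_kind).
Local Notation K := (scalars R k).

(* The norm of the library on ['rV_n] is the maximum norm. *)
Definition l2norm (n : nat) (x : 'rV[K]_n) : R :=
  Num.sqrt (\sum_(i < n) (scalar_re `|x 0 i|) ^+ 2).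

Definition opnorm (E F : lmodType K) (nE : E -> R) (nF : F -> R)
  (L : E -> F) : R := sup [set nF (L x) | x in [set x | nE x <= 1]].

Definition dBM_l2 (E : normedModType K) (n : nat) : R :=
  inf [set r : R | exists (L : {linear E -> 'rV[K]_n})
                          (L' : {linear 'rV[K]_n -> E}),
    [/\ cancel L L', cancel L' L
      & r = opnorm (@rnorm R k E) (@l2norm n) L
          * opnorm (@l2norm n) (@rnorm R k E) L']].

End BanachMazur.

Section Semigroups.
Context (R : realType) (k : scalar_kind) (tk : time_kind).
Local Notation K := (scalars R k).
Local Notation Time := (time_set (R := R) tk).
Context (X : normedModType K).
Implicit Types (V B G H : set X) (S : R -> X -> X) (T : R).

(* Only the values [S t x] with [t] in the time set and [x] in [V] matter. *)
Definition semigroup_on V S : Prop :=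
  [/\ forall t x, Time t -> V x -> V (S t x),
      forall x, V x -> S 0 x = x
    & forall t s x, Time t -> Time s -> V x -> S t (S s x) = S (t + s) x].

Definition ladyzhenskaya_type S B T (n : nat) (eta kappa : R)
    (Xn : submodClosed X) (P : X -> subspace_type Xn) : Prop :=
  [/\ (0 < n)%N, has_dimension (subspace_type Xn) n,
      0 <= eta < 1, 0 < kappa
    & forall x y, B x -> B y ->
        rnorm ((S T x - val (P (S T x))) - (S T y - val (P (S T y))))
          <= eta * rnorm (x - y)
        /\ rnorm (val (P (S T x)) - val (P (S T y))) <= kappa * rnorm (x - y)].

Definition compact_embedding (Z : normedModType K) (j : {linear Z -> X}) :=
  [/\ injective j, continuous j
    & forall A : set Z, bounded_set A -> precompact (j @` A)].

Definition smoothing_property S B T (eta kappa : R)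
    (Z : normedModType K) (j : {linear Z -> X}) (C : X -> X) (M : X -> Z) :=
  [/\ 0 <= eta < 1, 0 < kappa, compact_embedding j,
      forall x, B x -> S T x = C x + j (M x)
    & forall x y, B x -> B y ->
        rnorm (C x - C y) <= eta * rnorm (x - y)
        /\ rnorm (M x - M y) <= kappa * rnorm (x - y)].

Definition generalized_squeezing S B T (n : nat) (eta mu kappa : R) : Prop :=
  exists (E : normedModType K) (P : X -> E),
  [/\ (0 < n)%N /\ has_dimension E n, 0 <= eta < 1, 0 < mu, 0 < kappa
    & forall x y, B x -> B y ->
        rnorm (S T x - S T y)
          <= eta * rnorm (x - y) + mu * rnorm (P (S T x) - P (S T y))
        /\ rnorm (P (S T x) - P (S T y)) <= kappa * rnorm (x - y)].

(* Equal to [+oo] when no finite cover exists. *)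
Definition covering_number V G (eps : R) : \bar R :=
  ereal_inf [set ((size s)%:R%:E : \bar R) | s in
    [set s : seq X | (forall x, x \in s -> G x) /\
      G `<=` [set y | V y /\ exists2 x, x \in s & rnorm (y - x) < eps]]].

Definition fractal_dim V G : \bar R :=
  limf_esup (fun eps : R =>
    (lne (covering_number V G eps) * ((ln eps^-1)^-1)%:E)%E) (0 : R)^'+.

(* The supremum is taken in [[0, +oo]], so that it is 0 for empty [G]. *)
Definition semidist G H : \bar R :=
  ereal_sup ([set 0%E] `|`
    [set ereal_inf [set (rnorm (x - y))%:E | y in H] | x in G]).

Definition asymptotically_closed V S : Prop :=
  forall (t : R) (tn : nat -> R) (xn : nat -> X) (x y : X),
    Time t -> (forall i, Time (tn i)) -> tn i @[i --> \oo] --> +oo ->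
    (forall i, V (xn i)) -> bounded_set (range xn) -> V x -> V y ->
    S (tn i) (xn i) @[i --> \oo] --> x ->
    S (t + tn i) (xn i) @[i --> \oo] --> y ->
    S t x = y.

Definition absorbing_set V S B : Prop :=
  B `<=` V /\
  forall G, G `<=` V -> bounded_set G ->
    exists2 tG : R, Time tG &
      forall t : R, Time t -> tG <= t -> S t @` G `<=` B.

Definition discrete_exponential_attractor V S T (M0 : set X) : Prop :=
  [/\ M0 !=set0, compact M0 /\ M0 `<=` V, S T @` M0 `<=` M0,
      (fractal_dim V M0 < +oo)%E
    & exists2 xi : R, 0 < xi &
        forall G, G `<=` V -> bounded_set G ->
          ((expR (xi * t))%:E * semidist (S t @` G) M0)%E
            @[t --> within Time (pinfty_nbhs R)] --> 0%E].

End Semigroups.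

(* Main.v *)
(* Everything rests on a packing bound in a space of real dimension N: if m
   points have mutual distances in [rho, Delta] then m <= (1 + Delta / rho) ^ N.
   With b = 1 + Delta / rho, the m ^ J points \sum_(j < J) b ^ j p_(i_j) are
   still rho-separated and lie within distance rho b ^ J of a fixed point, while
   such a ball holds at most C b ^ (J N) of them; take J-th roots as J grows.

   Cut a piece of B of diameter D according to P S(T) at scale sigma D / 2. The
   images of the parts have diameter at most (eta + sigma) D, and there are at
   most (1 + 2 kappa / sigma) ^ N parts. Iterating gives the covering condition;
   the Banach-Mazur distance enters only through d_BM >= 1.

   For the attractor, pass to the positively invariant B1, the union of the
   S(jT)B for j large, choose nets E_j of S(jT)B1, and take the closure of all
   forward orbits of the E_j, where E_j is only counted from time j on. *)
Require Import Defs.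
From HB Require Import structures.
From mathcomp Require Import all_boot all_order all_algebra.
From mathcomp Require Import all_classical all_reals all_analysis.
From mathcomp Require Import complex.
From mathcomp Require Import ring lra.

Set Implicit Arguments.
Unset Strict Implicit.
Unset Printing Implicit Defensive.

Import Order.TTheory GRing.Theory Num.Theory.
Import numFieldNormedType.Exports.

Local Open Scope classical_set_scope.
Local Open Scope ring_scope.

(** * Real scalars and real-valued norms *)

Definition real_scalar (R : realType) (k : scalar_kind) : R -> scalars R k :=
  match k return R -> scalars R k with
  | RealScalars => fun a => a
  | ComplexScalars => fun a => real_complex R a
  end.
Arguments real_scalar {R} k a.

Section RealScalars.
Context (R : realType) (k : scalar_kind).
Local Notation K := (scalars R k).
Local Notation rs := (@real_scalar R k).
Implicit Types (a b : R) (z : K).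

Lemma real_scalarK a : scalar_re (rs a) = a.
Proof. by case: k. Qed.

Lemma real_scalarD a b : rs (a + b) = rs a + rs b.
Proof. by case: k => //=; rewrite rmorphD. Qed.

Lemma real_scalarM a b : rs (a * b) = rs a * rs b.
Proof. by case: k => //=; rewrite rmorphM. Qed.

Lemma real_scalarN a : rs (- a) = - rs a.
Proof. by case: k => //=; rewrite rmorphN. Qed.

Lemma real_scalar0 : rs 0 = 0.
Proof. by case: k. Qed.

Lemma ler_real_scalar a b : (rs a <= rs b) = (a <= b).
Proof. by case: k => //=; exact: lecR. Qed.

Lemma ltr_real_scalar a b : (rs a < rs b) = (a < b).
Proof. by case: k => //=; exact: ltcR. Qed.

(** Over the complex numbers, a nonnegative [z] has zero imaginary part by definition of the order.
    Hence every [K]-valued norm is the image of a real number, and estimates can be carried out in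
    [R]. *)
Lemma ger0_real_scalar z : 0 <= z -> z = rs (scalar_re z).
Proof. by case: k z => //= z /ger0_Im z0; case: z z0 => x y /= ->. Qed.

Lemma normr_real_scalar a : `|rs a| = rs `|a|.
Proof. by case: k => //=; rewrite normc_def/= expr0n addr0 sqrtr_sqr. Qed.

Lemma normrE_real_scalar z : `|z| = rs (scalar_re `|z|).
Proof. exact: ger0_real_scalar. Qed.

Lemma scalar_re_norm_ge0 z : 0 <= scalar_re `|z|.
Proof. by rewrite -ler_real_scalar -normrE_real_scalar real_scalar0. Qed.

End RealScalars.

Section RealNorm.
Context (R : realType) (k : scalar_kind) (E : normedModType (scalars R k)).
Local Notation rs := (@real_scalar R k).
Implicit Types (x y z : E) (a : R).

Lemma normr_rnorm x : `|x| = rs (rnorm x).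
Proof. exact: ger0_real_scalar. Qed.

Lemma rnorm_ge0 x : 0 <= rnorm x.
Proof. by rewrite -(ler_real_scalar k) -normr_rnorm real_scalar0. Qed.

Lemma ler_rnormD x y : rnorm (x + y) <= rnorm x + rnorm y.
Proof.
by rewrite -(ler_real_scalar k) real_scalarD -!normr_rnorm ler_normD.
Qed.

Lemma rnormN x : rnorm (- x) = rnorm x.
Proof. by rewrite /rnorm normrN. Qed.

Lemma rdistC x y : rnorm (x - y) = rnorm (y - x).
Proof. by rewrite -rnormN opprB. Qed.

Lemma ler_rdistD z x y : rnorm (x - y) <= rnorm (x - z) + rnorm (z - y).
Proof. by have := ler_rnormD (x - z) (z - y); rewrite addrA subrK. Qed.

Lemma ler_rdist_split (u v : E) x y :
  rnorm (x - y) <= rnorm ((x - u) - (y - v)) + rnorm (u - v).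
Proof.
by have := ler_rnormD ((x - u) - (y - v)) (u - v); rewrite addrACA -opprD !subrK.
Qed.

Lemma rnorm0 : rnorm (0 : E) = 0.
Proof. by rewrite /rnorm normr0 -(real_scalar0 R k) real_scalarK. Qed.

Lemma rnorm0_eq0 x : rnorm x = 0 -> x = 0.
Proof.
by move=> x0; apply: normr0_eq0; rewrite normr_rnorm x0 real_scalar0.
Qed.

Lemma rnorm_gt0 x : x != 0 -> 0 < rnorm x.
Proof.
move=> x0; rewrite lt_neqAle rnorm_ge0 andbT eq_sym.
by apply/eqP => /rnorm0_eq0/eqP; exact/negP.
Qed.

Lemma rnormZ (c : scalars R k) x : rnorm (c *: x) = scalar_re `|c| * rnorm x.
Proof.
rewrite {1}/rnorm normrZ normr_rnorm (normrE_real_scalar c) -real_scalarM.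
by rewrite !real_scalarK.
Qed.

Lemma rnormZ_real a x : rnorm (rs a *: x) = `|a| * rnorm x.
Proof. by rewrite rnormZ normr_real_scalar real_scalarK. Qed.

Lemma ler_rnorm_sum (I : Type) (r : seq I) (F : I -> E) :
  rnorm (\sum_(i <- r) F i) <= \sum_(i <- r) rnorm (F i).
Proof.
elim: r => [|i r IHr]; first by rewrite !big_nil rnorm0.
by rewrite !big_cons (le_trans (ler_rnormD _ _)) ?lerD.
Qed.

Lemma ball_rnorm x y a : ball x (rs a) y <-> rnorm (x - y) < a.
Proof. by rewrite -ball_normE/= normr_rnorm ltr_real_scalar. Qed.

Lemma nbhs_rnorm x (U : set E) :
  nbhs x U <-> exists2 e : R, 0 < e & forall y, rnorm (x - y) < e -> U y.
Proof.
split=> [/nbhs_ballP[e /= e0 xeU]|[e e0 xeU]].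
  have eE := ger0_real_scalar (ltW e0).
  exists (scalar_re e) => [|y /ball_rnorm].
    by rewrite -(ltr_real_scalar k) -eE real_scalar0.
  by rewrite -eE => /xeU.
apply/nbhs_ballP; exists (rs e) => [|y /ball_rnorm /xeU //].
by rewrite /= -(real_scalar0 R k) ltr_real_scalar.
Qed.

Lemma rnorm_continuous : continuous (@rnorm R k E).
Proof.
move=> x U /(@nbhs_normP R R)[e /= e0 eU]; apply/nbhs_rnorm; exists e => // y xy.
apply: eU; apply: le_lt_trans xy; rewrite ler_norml lerNl opprB !lerBlDr.
have := ler_rnormD (x - y) y; have := ler_rnormD (y - x) x.
by rewrite !subrK (rdistC y) => -> ->.
Qed.

Lemma closure_rnorm (A : set E) x :
  closure A x <-> forall e : R, 0 < e -> exists2 y, A y & rnorm (x - y) < e.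
Proof.
split=> [Ax e e0|Ax U /nbhs_rnorm[e /Ax[y Ay xy] xU]]; last first.
  by exists y; split=> //; exact: xU.
have [|y [Ay xy]] := Ax [set y | rnorm (x - y) < e]; last by exists y.
by apply/nbhs_rnorm; exists e.
Qed.

Lemma bounded_setP (A : set E) :
  bounded_set A <-> exists M : R, forall x, A x -> rnorm x <= M.
Proof.
rewrite /= /bounded_near; split=> [/pinfty_ex_gt0[M M0 AM]|[M AM]].
  exists (scalar_re M) => x /AM /=.
  by rewrite normr_rnorm {1}(ger0_real_scalar (ltW M0)) ler_real_scalar.
exists (rs M); split=> [|b Mb x /AM xM /=].
  by rewrite realE -(real_scalar0 R k) !ler_real_scalar le_total.
by rewrite (le_trans _ (ltW Mb))// normr_rnorm ler_real_scalar.
Qed.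

Lemma cvgn_rnorm (u : nat -> E) x :
  u i @[i --> \oo] --> x <->
  forall e : R, 0 < e -> exists N, forall i, (N <= i)%N -> rnorm (x - u i) < e.
Proof.
split=> [ux e e0|ux U /nbhs_rnorm[e /ux[N uN] xU]]; last first.
  by exists N => // i /uN /xU.
have [|N _ uN] := ux [set y | rnorm (x - y) < e]; last by exists N.
by apply/nbhs_rnorm; exists e.
Qed.

End RealNorm.

Lemma cauchy_seq_cvg (R : realType) (k : scalar_kind)
    (E : completeNormedModType (scalars R k)) (u : nat -> E) :
  (forall e : R, 0 < e -> exists N, forall i j, (N <= i)%N -> (N <= j)%N ->
     rnorm (u i - u j) < e) -> exists x : E, u i @[i --> \oo] --> x.
Proof.
move=> cu; apply/cvg_ex; apply/cauchy_cvgP.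
apply: cauchy_exP => e e0.
have eE := ger0_real_scalar (ltW e0).
have [|N uN] := cu (scalar_re e).
  by rewrite -(ltr_real_scalar k) -eE real_scalar0.
exists (u N); exists N => // i /= Ni; rewrite eE; apply/ball_rnorm.
exact: uN.
Qed.

(** In the complex case the vectors [e j] together with ['i *: e j] form a basis over the reals.
    This is the source of the exponent [2 * n]. *)
Lemma real_basis (R : realType) (k : scalar_kind)
    (E : normedModType (scalars R k)) n : has_dimension E n ->
  exists f : 'I_(real_dim k n) -> E,
    bijective (fun c : 'rV[R]_(real_dim k n) =>
      \sum_i real_scalar k (c 0 i) *: f i).
Proof.
case: k E => E [e be]; first by exists e.
have -> : real_dim ComplexScalars n = (n + n)%N by rewrite /= mul2n addnn.
pose f (i : 'I_(n + n)) : E :=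
  match fintype.split i with inl j => e j | inr j => ('i%C : R[i]) *: e j end.
pose phi (c : 'rV[R]_(n + n)) : 'rV[R[i]]_n :=
  \row_j (Complex (c 0 (lshift n j)) (c 0 (rshift n j))).
have bphi : bijective phi.
  exists (fun d : 'rV[R[i]]_n =>
    row_mx (\row_j complex.Re (d 0 j)) (\row_j complex.Im (d 0 j))).
    move=> c; apply/rowP => i; rewrite mxE; case: splitP => j ij; rewrite !mxE/=;
      by congr (c _ _); apply: val_inj.
  move=> d; apply/rowP => j; rewrite mxE row_mxEl row_mxEr !mxE.
  by case: (d 0 j).
exists f; have bephi := bij_comp be bphi.
apply: (eq_bij bephi) => c /=.
rewrite big_split_ord/= -big_split/=; apply: eq_bigr => j _.
rewrite /f (unsplitK (inl j)) (unsplitK (inr j)) scalerA -scalerDl !mxE.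
by congr (_ *: _); apply/eqP; rewrite eq_complex; simpc.
Qed.

(** * Packing in finite dimension *)

(** Coefficients are real even for complex scalars, so that [E] is treated as a real vector
    space. *)
Definition lincomb (R : realType) (k : scalar_kind) (E : normedModType (scalars R k))
    (N : nat) (f : 'I_N -> E) (c : 'rV[R]_N) : E :=
  \sum_i real_scalar k (c 0 i) *: f i.

Section LinearCombinations.
Context (R : realType) (k : scalar_kind) (E : normedModType (scalars R k)).
Context (N : nat) (f : 'I_N -> E).
Implicit Types c d : 'rV[R]_N.

Lemma lincombB c d : lincomb f (c - d) = lincomb f c - lincomb f d.
Proof.
rewrite /lincomb -sumrB; apply: eq_bigr => i _.
by rewrite !mxE real_scalarD real_scalarN scalerBl.
Qed.

Lemma lincombZ a c : lincomb f (a *: c) = real_scalar k a *: lincomb f c.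
Proof.
rewrite /lincomb scaler_sumr; apply: eq_bigr => i _.
by rewrite !mxE real_scalarM scalerA.
Qed.

Lemma rnorm_lincomb a c : (forall i, `|c 0 i| <= a) ->
  rnorm (lincomb f c) <= a * \sum_i rnorm (f i).
Proof.
move=> ca; rewrite (le_trans (ler_rnorm_sum _ _))// mulr_sumr ler_sum// => i _.
by rewrite rnormZ_real ler_wpM2r ?rnorm_ge0.
Qed.

Lemma ler_coord c i : `|c 0 i| <= `|c|.
Proof.
rewrite [leRHS]/Num.norm /= mx_normrE; apply/bigmax_geP; right => /=.
by exists (0, i).
Qed.

Lemma lincomb_continuous : continuous (lincomb f).
Proof.
move=> c U /nbhs_rnorm[e e0 eU]; apply/(@nbhs_normP R (matrix R 1 N) c).
have M0 : 0 <= \sum_i rnorm (f i) by apply: sumr_ge0 => i _; exact: rnorm_ge0.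
have M1 : 0 < \sum_i rnorm (f i) + 1 by rewrite ltr_wpDl.
exists (e / (\sum_i rnorm (f i) + 1)) => [|d /=]; first by rewrite /= divr_gt0.
rewrite ltr_pdivlMr// => cd; apply: eU; apply: le_lt_trans cd.
rewrite -lincombB (le_trans (rnorm_lincomb (ler_coord _)))//.
by rewrite ler_wpM2l// lerDl.
Qed.

(** The constant is the minimum of the norm over the compact unit sphere of coordinates; injectivity
    makes it positive, and homogeneity extends the bound to all coordinates. *)
Lemma rnorm_lincomb_ge : injective (lincomb f) ->
  exists2 delta : R, 0 < delta &
    forall c i, delta * `|c 0 i| <= rnorm (lincomb f c).
Proof.
move=> finj; suff [delta d0 dP] : exists2 delta : R, 0 < delta &
    forall c, delta * `|c| <= rnorm (lincomb f c).
  exists delta => // c i.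
  by rewrite (le_trans _ (dP c))// ler_wpM2l ?ler_coord// ltW.
have cont : continuous (fun c => rnorm (lincomb f c) : R).
  move=> c; apply: (@continuous_comp _ _ _ (lincomb f) (@rnorm R k E)).
    exact: lincomb_continuous.
  exact: rnorm_continuous.
pose A := [set c : 'rV[R]_N | `|c| = 1].
have cptA : compact A.
  apply: bounded_closed_compact.
    exists 1; split=> // b b1 c /= ->; exact: ltW.
  have -> : A = (fun c : 'rV[R]_N => `|c|) @^-1` [set 1].
    by apply/seteqP; split.
  apply: closed_comp => [c _|]; first exact: norm_continuous.
  exact: closed_eq.
(* The sphere is empty only in dimension 0, where every coordinate vector vanishes and any constant
   will do. *)
have [A0|/set0P An0] := eqVneq A set0.
  exists 1 => // c; have [->|c0] := eqVneq c 0.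
    by rewrite normr0 mulr0 rnorm_ge0.
  suff : A (`|c|^-1 *: c) by rewrite A0.
  by rewrite /A /= normrZ normfV normr_id mulVf// normr_eq0.
have [c0 /set_mem c0A c0min] := EVT_min_rV An0 cptA (continuous_subspaceT cont).
exists (rnorm (lincomb f c0)).
  apply: rnorm_gt0; apply: contra_eq_neq (c0A : `|c0| = 1) => fc0.
  suff -> : c0 = 0 by rewrite normr0 eq_sym oner_eq0.
  by apply: finj; rewrite fc0 -[0 in RHS](subrr 0) lincombB subrr.
move=> c; have [->|cn0] := eqVneq c 0.
  by rewrite normr0 mulr0 rnorm_ge0.
have cA : A (`|c|^-1 *: c).
  by rewrite /A /= normrZ normfV normr_id mulVf// normr_eq0.
have := c0min _ (mem_set cA).
rewrite lincombZ rnormZ_real normfV normr_id mulrC.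
by rewrite ler_pdivlMr ?normr_gt0.
Qed.

End LinearCombinations.
(** Separated points occupy distinct cells of a fine enough coordinate grid, and cells are counted.
    The constant [C] is crude; only the exponent [N] matters, since powers will later wash [C]
    out. *)
Lemma separated_card_poly (R : realType) (k : scalar_kind)
    (E : normedModType (scalars R k)) N (f : 'I_N -> E) (rho : R) :
  bijective (lincomb f) -> 0 < rho ->
  exists2 C : R, 0 < C & forall (I : finType) (p : I -> E) (r : R),
    (forall i j, i != j -> rho <= rnorm (p i - p j)) ->
    rho <= r -> (forall i, rnorm (p i) <= r) -> #|I|%:R <= (C * r) ^+ N.
Proof.
move=> [g fK gK] rho0; have [delta d0 dP] := rnorm_lincomb_ge (can_inj fK).
set M := \sum_i rnorm (f i).
have M0 : 0 <= M by apply: sumr_ge0 => i _; exact: rnorm_ge0.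
(* Cells have side [w^-1]: coordinates in a common cell give points at distance at most [M / w],
   which is less than [rho]. *)
pose w := (M + 1) / rho.
have w0 : 0 < w by rewrite divr_gt0// ltr_wpDl.
exists (2 * w / delta + rho^-1).
  by rewrite addr_gt0 ?invr_gt0// divr_gt0// mulr_gt0.
move=> I p r psep rhor pr.
have r0 : 0 < r by exact: lt_le_trans rhor.
(* The shift by [r / delta] makes the coordinates nonnegative before truncation. *)
pose x i j := (g (p i) 0 j + r / delta) * w.
have gr i j : `|g (p i) 0 j| <= r / delta.
  by rewrite ler_pdivlMr// mulrC (le_trans (dP _ _))// gK.
have x0 i j : 0 <= x i j.
  rewrite mulr_ge0 ?(ltW w0)//.
  by have := gr i j; rewrite ler_norml => /andP[]; lra.
pose L := (Num.trunc (2 * w * r / delta)).+1.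
have xL i j : (Num.trunc (x i j) < L)%N.
  rewrite ltnS le_truncn// /x.
  have -> : 2 * w * r / delta = (r / delta + r / delta) * w by field; rewrite gt_eqF.
  by rewrite ler_wpM2r ?(ltW w0)// lerD2r (le_trans (ler_norm _) (gr i j)).
pose c i : {ffun 'I_N -> 'I_L} := [ffun j => Ordinal (xL i j)].
have /leq_card : injective c.
  move=> i i' /ffunP cii'; apply/eqP; apply: contraT => /psep.
  rewrite -(gK (p i)) -(gK (p i')) -lincombB leNgt => /negP[].
  apply: (le_lt_trans (rnorm_lincomb (a := w^-1) _ _)).
    move=> j; rewrite !mxE.
    have /(congr1 val)/= := cii' j; rewrite !ffunE/= => xx.
    have /andP[h1 h2] := truncn_itv (x0 i j).
    have /andP[h3 h4] := truncn_itv (x0 i' j).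
    rewrite xx -natr1 in h1 h2; rewrite -natr1 in h4.
    rewrite -[leRHS]mul1r ler_pdivlMr// -{1}(gtr0_norm w0) -normrM mulrBl.
    rewrite ler_norml; move: h1 h2 h3 h4; rewrite /x !mulrDl; lra.
  by rewrite -/M /w invf_div mulrAC ltr_pdivrMr ?ltr_wpDl// ltr_pM2l// ltrDl.
rewrite card_ffun !card_ord => cardI.
(* The extra cell counted by the successor is paid for by [rho^-1 * r], which is at least 1 because
   [rho <= r]. *)
have Lr : L%:R <= (2 * w / delta + rho^-1) * r.
  rewrite -[leLHS]natr1 [leRHS]mulrDl lerD//.
    have -> : 2 * w / delta * r = 2 * w * r / delta by rewrite mulrAC.
    rewrite truncn_le divr_ge0 ?(ltW d0)// mulr_ge0 ?(ltW r0)//.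
    by rewrite mulr_ge0 ?(ltW w0).
  by rewrite mulrC ler_pdivlMr// mul1r.
apply: (le_trans (y := (L ^ N)%:R)); first by rewrite ler_nat.
by rewrite natrX lerXn2r ?nnegrE// (le_trans _ Lr).
Qed.

(** By Bernoulli's inequality the powers of a number above 1 grow at least linearly. *)
Lemma le1_of_bounded_expr (R : realType) (x C : R) :
  0 <= x -> (forall J : nat, x ^+ J <= C) -> x <= 1.
Proof.
move=> x0 xC; rewrite leNgt; apply/negP => x1.
have h J : 1 + (x - 1) *+ J <= x ^+ J.
  elim: J => [|J IH]; first by rewrite mulr0n addr0 expr0.
  rewrite exprS mulrS; have : 0 <= (x - 1) *+ J by rewrite mulrn_wge0// subr_ge0 ltW.
  by move: IH; set a := _ *+ J; set b := _ ^+ J; nra.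
have x1' : 0 < x - 1 by rewrite subr_gt0.
have C0 : 0 <= C / (x - 1).
  by rewrite divr_ge0 ?(ltW x1')// (le_trans _ (xC 0%N))// expr0.
have := xC (Num.trunc (C / (x - 1))).+1; apply/negP; rewrite -ltNge.
apply: lt_le_trans (h _); rewrite -mulr_natr.
have := truncnS_gt (C / (x - 1)); rewrite ltr_pdivrMr// mulrC => h'.
by rewrite (lt_trans h')// ltrDr.
Qed.

(* The points [\sum_j b ^+ j * p (i j)] with [b = 1 + Delta / rho] are again
   [rho]-separated: there are [m ^ J] of them within radius [rho * b ^+ J]. *)
Lemma separated_expansion (R : realType) (k : scalar_kind)
    (E : normedModType (scalars R k)) m (p : 'I_m -> E) (rho Delta : R) :
  0 < rho -> 0 <= Delta ->
  (forall i j, i != j -> rho <= rnorm (p i - p j)) ->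
  (forall i, rnorm (p i) <= Delta) -> (forall i j, rnorm (p i - p j) <= Delta) ->
  forall J, exists (I : finType) (q : I -> E),
  [/\ #|I| = (m ^ J)%N, forall i j, i != j -> rho <= rnorm (q i - q j)
    & forall i, rnorm (q i) + rho <= (1 + Delta / rho) ^+ J * rho].
Proof.
move=> rho0 D0 psep pD pD'; pose b := 1 + Delta / rho.
have b0 : 0 < b by rewrite ltr_pwDl// divr_ge0// ltW.
have brho : b * rho = rho + Delta by rewrite mulrDl mul1r mulfVK// gt_eqF.
elim=> [|J [I [q [cI qsep qr]]]].
  exists 'I_1, (fun=> 0); split=> [|i j|i]; first by rewrite card_ord.
    by rewrite (ord1 i) (ord1 j) eqxx.
  by rewrite rnorm0 add0r expr0 mul1r.
exists (I * 'I_m)%type, (fun ij => real_scalar k b *: q ij.1 + p ij.2); split.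
- by rewrite card_prod card_ord cI expnSr.
- move=> [i s] [j t] /=; rewrite xpair_eqE negb_and.
  rewrite opprD addrACA -scalerBr.
  have [<-{j} /= st|ij _] := eqVneq i j.
    by rewrite subrr scaler0 add0r psep.
  (* Scaling by [b] pushes these points at least [rho + Delta] apart; the added terms differ by at
     most [Delta], so [rho] remains. *)
  have h : b * rho <= rnorm (real_scalar k b *: (q i - q j)).
    by rewrite rnormZ_real gtr0_norm// ler_wpM2l ?qsep// ltW.
  have := ler_rnormD (real_scalar k b *: (q i - q j) + (p s - p t)) (- (p s - p t)).
  by rewrite addrK rnormN; have := pD' s t; lra.
- move=> [i s] /=; rewrite exprS -mulrA.
  have := ler_rnormD (real_scalar k b *: q i) (p s).
  rewrite rnormZ_real gtr0_norm//; have := pD s.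
  have := qr i; rewrite -/b -(ler_pM2l b0) mulrDr brho; lra.
Qed.

(** The crude count applied to the expanded family gives [m ^ J <= (C * rho) ^ N * (b ^ N) ^ J] for
    every [J]. So the powers of [m / b ^ N] stay bounded, and the constant disappears. *)
Lemma separated_card (R : realType) (k : scalar_kind)
    (E : normedModType (scalars R k)) n m (p : 'I_m -> E) (rho Delta : R) :
  has_dimension E n -> 0 < rho -> 0 <= Delta ->
  (forall i j, i != j -> rho <= rnorm (p i - p j)) ->
  (forall i j, rnorm (p i - p j) <= Delta) ->
  m%:R <= (1 + Delta / rho) ^+ real_dim k n.
Proof.
move=> /real_basis[f bf] rho0 D0; set N := real_dim k n.
have b1 : 1 <= 1 + Delta / rho by rewrite lerDl divr_ge0// ltW.
case: m p => [|m] p psep pD; first by rewrite exprn_ge0// (le_trans _ b1).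
set b := 1 + Delta / rho in b1 *.
have b0 : 0 < b by exact: lt_le_trans b1.
have bN0 : 0 < b ^+ N by rewrite exprn_gt0.
have [C C0 CP] := separated_card_poly bf rho0.
rewrite -[leRHS]mul1r -ler_pdivrMr//; apply: (@le1_of_bounded_expr _ _ ((C * rho) ^+ N)).
  by rewrite divr_ge0// ltW.
(* Translation by [p ord0] turns the bound on mutual distances into a bound on norms; this is why
   [m = 0] was set apart. *)
move=> J; have [|||I [q [cI qsep qr]]] :=
  @separated_expansion _ _ E m.+1 (fun i => p i - p ord0) rho Delta rho0 D0 _ _ _ J.
- by move=> i j ij; rewrite opprB addrA subrK psep.
- by move=> i; exact: pD.
- by move=> i j; rewrite opprB addrA subrK pD.
have := CP I q (b ^+ J * rho) qsep _ _.
rewrite cI natrX expr_div_n ler_pdivrMr ?exprn_gt0//.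
rewrite [b ^+ J * _]mulrC mulrA [in X in _ -> X]exprAC -exprMn; apply.
  by rewrite ler_pMr// exprn_ege1.
by move=> i; rewrite mulrC (le_trans _ (qr i))// lerDl ltW.
Qed.

(** * Finite-dimensional subspaces and the Banach-Mazur distance *)

Section FiniteDimensionalSubspace.
Context (R : realType) (k : scalar_kind) (X : normedModType (scalars R k)).
Context (W : submodClosed X).

Lemma rnorm_val (x : subspace_type W) : rnorm (val x) = rnorm x.
Proof. by []. Qed.

Lemma val_continuous : continuous (subspace_incl W).
Proof.
move=> x U /nbhs_rnorm[e e0 eU]; apply/nbhs_rnorm; exists e => // y xy.
by apply: eU; rewrite -raddfB.
Qed.

(** Coordinates are controlled by the norm, so a bounded set lies in the continuous image of a
    compact box. *)
Lemma subspace_compact_embedding n : has_dimension (subspace_type W) n ->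
  compact_embedding (subspace_incl W).
Proof.
move=> /real_basis[f [g fK gK]].
split; [exact: val_inj|exact: val_continuous|move=> A /bounded_setP[M AM]].
have [delta d0 dP] := rnorm_lincomb_ge (can_inj fK).
pose b := M / delta.
pose box := [set c : 'rV[R]_(real_dim k n) | forall i, `[- b, b]%classic (c 0 i)].
have cptbox : compact box.
  by apply: (@rV_compact _ _ (fun=> `[- b, b]%classic)) => i; exact: segment_compact.
pose h := subspace_incl W \o lincomb f.
have : compact (h @` box).
  apply: continuous_compact => //; apply: continuous_subspaceT => c.
  apply: continuous_comp; [exact: lincomb_continuous|exact: val_continuous].
move=> /(compact_precompact (@norm_hausdorff _ X)); apply: precompact_subset.
move=> _ [x Ax <-]; exists (g x); last by rewrite /h /= /lincomb gK.
move=> i; rewrite /= in_itv/= -ler_norml ler_pdivlMr// mulrC.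
by rewrite (le_trans (dP _ _))// /lincomb gK AM.
Qed.

End FiniteDimensionalSubspace.

Section BanachMazurDistance.
Context (R : realType) (k : scalar_kind).
Local Notation K := (scalars R k).

Lemma l2norm_ge0 n (c : 'rV[K]_n) : 0 <= l2norm c.
Proof. exact: sqrtr_ge0. Qed.

Lemma ler_l2norm n (c : 'rV[K]_n) i : scalar_re `|c 0 i| <= l2norm c.
Proof.
rewrite -[leLHS]ger0_norm ?scalar_re_norm_ge0// -sqrtr_sqr.
rewrite ler_wsqrtr// (bigD1 i)//= lerDl.
by apply: sumr_ge0 => j _; rewrite sqr_ge0.
Qed.

Lemma l2norm_le n (c : 'rV[K]_n) a : 0 <= a ->
  (forall i, scalar_re `|c 0 i| <= a) -> l2norm c <= Num.sqrt n%:R * a.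
Proof.
move=> a0 ca; rewrite -[X in _ <= _ * X](ger0_norm a0) -sqrtr_sqr -sqrtrM ?ler0n//.
rewrite ler_wsqrtr// mulr_natl -[in leRHS](card_ord n) -sumr_const ler_sum// => i _.
by rewrite lerXn2r// nnegrE scalar_re_norm_ge0.
Qed.

Lemma l2normZ_real n a (c : 'rV[K]_n) :
  l2norm (real_scalar k a *: c) = `|a| * l2norm c.
Proof.
rewrite /l2norm -[in RHS]sqrtr_sqr -[in RHS]sqrtrM ?sqr_ge0//.
congr Num.sqrt; rewrite mulr_sumr; apply: eq_bigr => i _.
rewrite mxE normrM normr_real_scalar (normrE_real_scalar (c 0 i)).
by rewrite -real_scalarM !real_scalarK exprMn real_normK ?num_real.
Qed.

Lemma ler_opnorm (E F : lmodType K) (nE : E -> R) (nF : F -> R)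
    (L : {linear E -> F}) :
  (forall x, 0 <= nE x) ->
  (forall a x, nE (real_scalar k a *: x) = `|a| * nE x) ->
  (forall a x, nF (real_scalar k a *: x) = `|a| * nF x) ->
  (exists C, forall x, nF (L x) <= C * nE x) ->
  forall x, nF (L x) <= opnorm nE nF L * nE x.
Proof.
move=> nE0 nEZ nFZ [C LC] x.
have [x0|x0] := eqVneq (nE x) 0; first by have := LC x; rewrite x0 !mulr0.
have {}x0 : 0 < nE x by rewrite lt_neqAle eq_sym x0 nE0.
rewrite -ler_pdivrMr// mulrC -[(nE x)^-1]ger0_norm ?invr_ge0// -nFZ -linearZ.
apply: ub_le_sup => /=.
  exists (Num.max C 0) => _ [y /= y1 <-]; rewrite (le_trans (LC y))//.
  rewrite (le_trans (y := Num.max C 0 * nE y))//.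
    by rewrite ler_wpM2r// le_max lexx.
  by rewrite ler_piMr// le_max lexx orbT.
exists (real_scalar k (nE x)^-1 *: x) => //=.
by rewrite nEZ ger0_norm ?invr_ge0// mulVf// gt_eqF.
Qed.

Lemma has_dimension_iso (E : normedModType K) n : has_dimension E n ->
  exists (L : {linear E -> 'rV[K]_n}) (L' : {linear 'rV[K]_n -> E}),
    cancel L L' /\ cancel L' L.
Proof.
move=> [e [g fK gK]]; set f := fun c : 'rV[K]_n => _ in fK gK.
have flin : linear f.
  move=> a c d; rewrite /f scaler_sumr -big_split/=; apply: eq_bigr => i _.
  by rewrite !mxE scalerDl scalerA.
pose fL := GRing.isLinear.Build _ _ _ _ f flin.
pose L' : {linear 'rV[K]_n -> E} := HB.pack f fL.
have glin : linear g := can2_linear (f := L') fK gK.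
pose gL := GRing.isLinear.Build _ _ _ _ g glin.
pose L : {linear E -> 'rV[K]_n} := HB.pack g gL.
by exists L, L'.
Qed.

(** Each real coordinate of [x] is at most [rnorm x / delta], so the images of the finitely many
    basis vectors bound the whole map. *)
Lemma linear_to_l2_bounded (E : normedModType K) n
    (L : {linear E -> 'rV[K]_n}) : has_dimension E n ->
  exists C, forall x, l2norm (L x) <= C * rnorm x.
Proof.
move=> /real_basis[f [g fK gK]].
have [delta d0 dP] := rnorm_lincomb_ge (can_inj fK).
pose M := \sum_i l2norm (L (f i)).
have M0 : 0 <= M by apply: sumr_ge0 => i _; exact: l2norm_ge0.
exists (Num.sqrt n%:R * (M / delta)) => x; rewrite -mulrA; apply: l2norm_le.
  by rewrite mulr_ge0 ?rnorm_ge0// divr_ge0// ltW.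
move=> i; rewrite -{1}(gK x) linear_sum summxE.
rewrite -(ler_real_scalar k) -normrE_real_scalar.
rewrite (le_trans (ler_norm_sum _ _ _))//.
rewrite (le_trans (y := \sum_j real_scalar k (rnorm x / delta * l2norm (L (f j)))))//.
  apply: ler_sum => j _; rewrite linearZ mxE normrM normr_real_scalar.
  rewrite (normrE_real_scalar (L (f j) 0 i)) -real_scalarM ler_real_scalar.
  rewrite ler_pM ?ler_l2norm ?scalar_re_norm_ge0//.
  by rewrite ler_pdivlMr// mulrC (le_trans (dP _ _))// /lincomb gK.
rewrite -(big_morph _ (real_scalarD k) (real_scalar0 R k)) ler_real_scalar.
by rewrite -mulr_sumr -/M mulrAC [leRHS]mulrC mulrA.
Qed.

Lemma linear_of_l2_bounded (E : normedModType K) n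
    (L : {linear 'rV[K]_n -> E}) :
  exists C, forall c, rnorm (L c) <= C * l2norm c.
Proof.
exists (\sum_i rnorm (L (delta_mx 0 i))) => c.
rewrite {1}(row_sum_delta c) linear_sum (le_trans (ler_rnorm_sum _ _))//.
rewrite mulr_suml ler_sum// => i _.
by rewrite linearZ rnormZ mulrC ler_wpM2l ?rnorm_ge0// ler_l2norm.
Qed.

(** For an isomorphism [L] with inverse [L'] and one nonzero [x], writing [x = L' (L x)] bounds
    [rnorm x] by the product of the operator norms times [rnorm x]. *)
Lemma dBM_l2_ge1 (E : normedModType K) n : (0 < n)%N -> has_dimension E n ->
  1 <= dBM_l2 E n.
Proof.
move=> n0 En; apply: lb_le_inf.
  (* A lower bound passes to [inf] only for a nonempty set, so some isomorphism has to be
     exhibited. *)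
  have [L [L' [LK L'K]]] := has_dimension_iso En.
  by exists (opnorm (@rnorm R k E) (@l2norm R k n) L
          * opnorm (@l2norm R k n) (@rnorm R k E) L'), L, L'.
move=> _ [L [L' [LK L'K ->]]].
pose x := L' (delta_mx 0 (Ordinal n0)).
have x0 : 0 < rnorm x.
  apply: rnorm_gt0; apply/eqP => /(congr1 L); rewrite L'K linear0.
  move/matrixP/(_ 0 (Ordinal n0)); rewrite !mxE !eqxx/= => /eqP.
  by rewrite oner_eq0.
have l2 := ler_opnorm (@l2norm_ge0 n) (@l2normZ_real n) (@rnormZ_real R k E)
  (linear_of_l2_bounded L').
have l1 := ler_opnorm (@rnorm_ge0 R k E) (@rnormZ_real R k E) (@l2normZ_real n)
  (linear_to_l2_bounded L En).
set B := opnorm _ _ L' in l2 *; set A := opnorm _ _ L in l1 *.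
have l2x : rnorm x <= B * l2norm (L x) by rewrite -{1}(LK x) l2.
have B0 : 0 <= B.
  rewrite leNgt; apply/negP => B0; move: (lt_le_trans x0 l2x).
  by rewrite ltNge mulr_le0_ge0 ?l2norm_ge0 ?(ltW B0).
rewrite -(ler_pM2r x0) mul1r (le_trans l2x)// [A * B]mulrC -mulrA.
by rewrite ler_wpM2l.
Qed.

End BanachMazurDistance.

(** * Coverings by sets of small diameter *)

Section TimeSet.
Context (R : realType) (tk : time_kind).
Local Notation Time := (time_set (R := R) tk).

Lemma time_set0 : Time 0.
Proof. by case: tk => /=; [exact: lexx|exists 0%N]. Qed.

Lemma time_set_ge0 t : Time t -> 0 <= t.
Proof. by case: tk => //= -[m _ <-]. Qed.

Lemma time_setD s t : Time s -> Time t -> Time (s + t).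
Proof.
case: tk => /= [|[m _ <-] [p _ <-]]; first exact: addr_ge0.
by exists (m + p)%N => //; rewrite natrD.
Qed.

Lemma time_setB s t : Time s -> Time t -> s <= t -> Time (t - s).
Proof.
case: tk => /= [_ _|[m _ <-] [p _ <-]]; first by rewrite subr_ge0.
by rewrite ler_nat => mp; exists (p - m)%N => //; rewrite natrB.
Qed.

Lemma time_setMn T j : Time T -> Time (j%:R * T).
Proof.
move=> TT; elim: j => [|j IHj]; first by rewrite mul0r; exact: time_set0.
by rewrite -natr1 mulrDl mul1r; exact: time_setD.
Qed.

End TimeSet.

Section Covers.
Context (R : realType) (k : scalar_kind) (X : normedModType (scalars R k)).
Implicit Types (A G : set X) (D h : R).

Definition diam_le A D := forall x y, A x -> A y -> rnorm (x - y) <= D.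

(** The count is bounded by a real [h] so that growth factors multiply. Pieces are subsets of [G]
    because the covering number wants centres in [G]. *)
Definition diam_cover G D h := exists l : seq (set X),
  [/\ (size l)%:R <= h, forall x, G x -> exists2 A, A \in l & A x
    & forall A, A \in l -> A `<=` G /\ diam_le A D].

(** Each piece is replaced by a cover of its own image, so the counts multiply; this is the
    induction step for iterates of [S T]. *)
Lemma diam_cover_image (phi : X -> X) G D D' h h' : 0 <= h' ->
  diam_cover G D h ->
  (forall A, A `<=` G -> diam_le A D -> diam_cover (phi @` A) D' h') ->
  diam_cover (phi @` G) D' (h * h').
Proof.
move=> h'0 [l [lh Gl lD]] step.
suff [l' [l'h l'G l'D]] : exists l' : seq (set X),
    [/\ (size l')%:R <= (size l)%:R * h',
        forall A x, A \in l -> A x -> exists2 A', A' \in l' & A' (phi x)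
      & forall A, A \in l' -> A `<=` phi @` G /\ diam_le A D'].
  exists l'; split=> //; first by rewrite (le_trans l'h)// ler_wpM2r.
  by move=> _ [x /Gl[A Al Ax] <-]; exact: l'G Ax.
elim: l {lh Gl} lD => [|A l IHl] lD; first by exists [::]; split=> //=; rewrite mul0r.
have [|l1 [l1h l1G l1D]] := IHl.
  by move=> A' A'l; apply: lD; rewrite inE A'l orbT.
have [AG AD] := lD A (mem_head _ _).
have [l2 [l2h l2G l2D]] := step A AG AD.
exists (l2 ++ l1); split.
- by rewrite size_cat natrD /= -natr1 mulrDl mul1r addrC lerD.
- move=> A' x; rewrite inE => /predU1P[->{A'} Ax|A'l A'x].
    have [|A2 A2l A2x] := l2G (phi x); first by exists x.
    by exists A2 => //; rewrite mem_cat A2l.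
  have [A2 A2l A2x] := l1G _ _ A'l A'x.
  by exists A2 => //; rewrite mem_cat A2l orbT.
- move=> A'; rewrite mem_cat => /orP[/l2D[A'A A'D]|/l1D//]; split=> //.
  by move=> _ /A'A[x /AG Gx <-]; exists x.
Qed.

(** One point is chosen in each nonempty piece. *)
Lemma diam_cover_net G D h : diam_cover G D h -> exists s : seq X,
  [/\ (size s)%:R <= h, forall x, x \in s -> G x
    & forall x, G x -> exists2 y, y \in s & rnorm (x - y) <= D].
Proof.
move=> [l [lh Gl lD]].
suff [s [sl sG sD]] : exists s : seq X,
    [/\ (size s <= size l)%N, forall x, x \in s -> G x
      & forall A x, A \in l -> A x -> exists2 y, y \in s & rnorm (x - y) <= D].
  exists s; split=> //; first by rewrite (le_trans _ lh)// ler_nat.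
  by move=> x /Gl[A Al Ax]; exact: sD Ax.
elim: l {lh Gl} lD => [|A l IHl] lD; first by exists [::].
have [|s [sl sG sD]] := IHl.
  by move=> A' A'l; apply: lD; rewrite inE A'l orbT.
have [AG AD] := lD A (mem_head _ _).
have [A0|/set0P[a Aa]] := eqVneq A set0.
  exists s; split=> //; first exact: leqW.
  by move=> A' x; rewrite inE A0 => /predU1P[->//|]; exact: sD.
exists (a :: s); split=> //.
  by move=> x; rewrite inE => /predU1P[->|/sG//]; exact: AG.
move=> A' x; rewrite inE => /predU1P[->{A'} Ax|A'l A'x].
  by exists a; rewrite ?mem_head//; exact: AD.
have [y ys xy] := sD _ _ A'l A'x.
by exists y => //; rewrite inE ys orbT.
Qed.

Lemma covering_number_le (V : set X) G eps (s : seq X) : G `<=` V ->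
  (forall x, x \in s -> G x) ->
  (forall x, G x -> exists2 y, y \in s & rnorm (x - y) < eps) ->
  (covering_number V G eps <= (size s)%:R%:E)%E.
Proof.
move=> GV sG Gs; apply: ereal_inf_lbound => /=; exists s => //; split=> // x Gx.
by split; [exact: GV|exact: Gs].
Qed.

(** The bound [h] yields a separated family of largest size. A point far from all its members could
    be appended, so there is none. Distances are measured after [phi], which will be [P] composed
    with [S T]. *)
Lemma maximal_separated (Y : Type) (A : set Y) (phi : Y -> X) (rho h : R) :
  (forall m (y : 'I_m -> Y), (forall i, A (y i)) ->
     (forall i j, i != j -> rho <= rnorm (phi (y i) - phi (y j))) ->
     m%:R <= h) ->
  exists m (y : 'I_m -> Y), [/\ m%:R <= h, forall i, A (y i)
    & forall x, A x -> exists i, rnorm (phi x - phi (y i)) < rho].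
Proof.
move=> sep_le.
pose sep m := `[< exists y : 'I_m -> Y, (forall i, A (y i)) /\
  forall i j, i != j -> rho <= rnorm (phi (y i) - phi (y j)) >].
have ex_sep : exists m, sep m.
  exists 0%N; apply/asboolP.
  by exists (fun i : 'I_0 => False_rect _ (notF (ltn_ord i))); split=> -[].
have sep_bd m : sep m -> (m <= Num.trunc h)%N.
  move=> /asboolP[y [yA ysep]]; have mh := sep_le m y yA ysep.
  by rewrite truncn_ge_nat// (le_trans _ mh).
case: (ex_maxnP ex_sep sep_bd) => m /asboolP[y [yA ysep]] mmax.
exists m, y; split=> //; first exact: sep_le ysep.
move=> x Ax; apply: contrapT => /forallNP xfar.
have {}xfar i : rho <= rnorm (phi x - phi (y i)) by rewrite leNgt; apply/negP.
suff /mmax : sep m.+1 by rewrite ltnn.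
pose y' i := if unlift ord_max i is Some j then y j else x.
apply/asboolP; exists y'; split=> [i|i j].
  by rewrite /y'; case: unliftP => [j _|_].
rewrite /y'; case: unliftP => [i' ->|->]; case: unliftP => [j' ->|->].
- by move=> ij; apply: ysep; apply: contraNneq ij => ->.
- by rewrite rdistC.
- by [].
- by rewrite eqxx.
Qed.

End Covers.

(** * Coverings of the iterates under the Ladyzhenskaya condition *)

Section Ladyzhenskaya.
Context (R : realType) (k : scalar_kind) (tk : time_kind).
Context (X : normedModType (scalars R k)) (V B : set X) (S : R -> X -> X).
Context (T : R) (n : nat) (eta kappa sigma : R).
Context (Xn : submodClosed X) (P : X -> subspace_type Xn).
Hypotheses (sgS : semigroup_on tk V S) (BV : B `<=` V) (TT : time_set tk T).
Hypotheses (LS : ladyzhenskaya_type S B T n eta kappa P) (sigma0 : 0 < sigma).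

Let h := (1 + 2 * kappa / sigma) ^+ real_dim k n.

Lemma growth_ge1 : 1 <= h.
Proof.
have [_ _ _ k0 _] := LS.
by rewrite exprn_ege1// lerDl divr_ge0 ?mulr_ge0// ltW.
Qed.

(* The pieces are cut by [P] at scale [sigma * D / 2]: their images then have
   diameter at most [eta * D + 2 * (sigma * D / 2)]. *)
Lemma ladyzhenskaya_diam_cover A D : A `<=` B -> 0 < D -> diam_le A D ->
  diam_cover (S T @` A) ((eta + sigma) * D) h.
Proof.
move=> AB D0 AD; have [_ Pn _ k0 LP] := LS.
pose rho := sigma * D / 2.
have rho0 : 0 < rho by rewrite divr_gt0// mulr_gt0.
have [|m [y [mh yA Ay]]] :=
  @maximal_separated _ _ (subspace_type Xn) X A (fun x => P (S T x)) rho h.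
  move=> m y yA ysep.
  (* Packing is used with [Delta = kappa * D] and [rho = sigma * D / 2]; their ratio
     [2 * kappa / sigma] does not depend on [D], so the same [h] serves at every scale. *)
  have -> : h = (1 + kappa * D / rho) ^+ real_dim k n.
    by rewrite /h /rho; congr ((1 + _) ^+ _); field; rewrite !gt_eqF.
  apply: (separated_card Pn rho0 _ ysep); first by rewrite mulr_ge0 ?ltW.
  move=> i j; have [_] := LP _ _ (AB _ (yA i)) (AB _ (yA j)).
  rewrite -raddfB rnorm_val => /le_trans; apply.
  by rewrite ler_wpM2l ?(ltW k0)// AD.
pose piece i := [set S T x | x in
  A `&` [set x | rnorm (P (S T x) - P (S T (y i))) < rho]].
exists [seq piece i | i <- enum 'I_m]; split.
- by rewrite size_map size_enum_ord.
- move=> _ [x Ax <-]; have [i xi] := Ay x Ax.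
  by exists (piece i); [apply: map_f; rewrite mem_enum|exists x].
- move=> _ /mapP[i _ ->]; split=> [_ [x [Ax _] <-]|]; first by exists x.
  move=> _ _ [x [Ax /= xi] <-] [z [Az /= zi] <-].
  have [h1 _] := LP _ _ (AB _ Ax) (AB _ Az).
  have h2 : rnorm (val (P (S T x)) - val (P (S T z))) <= sigma * D.
    rewrite -raddfB rnorm_val (le_trans (ler_rdistD (P (S T (y i))) _ _))//.
    rewrite [X in _ + X]rdistC (le_trans (lerD (ltW xi) (ltW zi)))//.
    by rewrite /rho -splitr.
  have h3 : eta * rnorm (x - z) <= eta * D.
    by rewrite ler_wpM2l ?AD//; have [_ _ /andP[]] := LS.
  rewrite (le_trans (ler_rdist_split (val (P (S T x))) (val (P (S T z))) _ _))//.
  by rewrite mulrDl lerD// (le_trans h1).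
Qed.

Hypotheses (SB : S T @` B `<=` B).

Lemma semigroup_iter0 x : B x -> S (0%:R * T) x = x.
Proof. by move=> /BV Vx; rewrite mul0r; have [_ ->] := sgS. Qed.

Lemma semigroupS j x : B x -> S (j.+1%:R * T) x = S T (S (j%:R * T) x).
Proof.
move=> /BV Vx; have [_ _ SD] := sgS.
by rewrite SD//; [rewrite -natr1 mulrDl mul1r addrC|exact: time_setMn].
Qed.

Lemma semigroup_iter_sub j : S (j%:R * T) @` B `<=` B.
Proof.
elim: j => [|j IHj] _ [x Bx <-].
  by rewrite semigroup_iter0.
by rewrite semigroupS//; apply: SB; exists (S (j%:R * T) x) => //; apply: IHj; exists x.
Qed.

Lemma semigroup_iter_diam_cover D j : 0 < D -> diam_le B D ->
  diam_cover (S (j%:R * T) @` B) (D * (eta + sigma) ^+ j) (h ^+ j).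
Proof.
move=> D0 BD.
have q0 : 0 < eta + sigma by have [_ _ /andP[? _] _ _] := LS; rewrite ltr_wpDl.
elim: j => [|j IHj].
  exists [:: B]; split; first by rewrite expr0.
    move=> _ [x Bx <-]; exists B; first exact: mem_head.
    by rewrite semigroup_iter0.
  move=> A; rewrite inE => /eqP->; rewrite expr0 mulr1; split=> // x Bx.
  by exists x => //; rewrite semigroup_iter0.
have -> : S (j.+1%:R * T) @` B = S T @` (S (j%:R * T) @` B).
  apply/seteqP; split=> [_ [x Bx <-]|_ [_ [x Bx <-] <-]].
    by exists (S (j%:R * T) x); [exists x|rewrite semigroupS].
  by exists x => //; rewrite semigroupS.
rewrite [h ^+ _]exprSr; apply: diam_cover_image IHj _.
  exact: le_trans growth_ge1.
move=> A Aj AD; rewrite exprSr mulrA [X in diam_cover _ X]mulrC.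
apply: ladyzhenskaya_diam_cover => //; last by rewrite mulr_gt0// exprn_gt0.
by move=> x /Aj; exact: semigroup_iter_sub.
Qed.

Lemma semigroup_iter_net D j : 0 < D -> diam_le B D -> exists s : seq X,
  [/\ (size s)%:R <= h ^+ j, forall x, x \in s -> (S (j%:R * T) @` B) x
    & forall x, (S (j%:R * T) @` B) x ->
        exists2 y, y \in s & rnorm (x - y) <= D * (eta + sigma) ^+ j].
Proof. by move=> D0 BD; apply: diam_cover_net; exact: semigroup_iter_diam_cover. Qed.

End Ladyzhenskaya.

Lemma bounded_diam_le (R : realType) (k : scalar_kind)
    (X : normedModType (scalars R k)) (A : set X) :
  bounded_set A -> exists2 D, 0 < D & diam_le A D.
Proof.
move=> /bounded_setP[M AM]; exists (2 * `|M| + 1) => [|x y /AM xM /AM yM].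
  by rewrite ltr_wpDl// mulr_ge0.
rewrite (le_trans (ler_rnormD _ _))// rnormN.
by have := ler_norm M; move: xM yM; lra.
Qed.

Lemma growth_le_dBM (R : realType) (k : scalar_kind)
    (E : normedModType (scalars R k)) n (kappa sigma : R) :
  (0 < n)%N -> has_dimension E n -> 0 < kappa -> 0 < sigma ->
  1 + 2 * kappa / sigma <= 1 + 2 * kappa * dBM_l2 E n / sigma.
Proof.
move=> n0 En k0 s0; rewrite lerD2l ler_pM2r ?invr_gt0// ler_pMr ?mulr_gt0//.
exact: dBM_l2_ge1.
Qed.

(** * Fractal dimension and compactness from nets *)

Lemma expr_lt_of_ln (R : realType) (q x : R) K : 0 < q -> 0 < x ->
  - ln x < K%:R * ln q^-1 -> q ^+ K < x.
Proof.
move=> q0 x0 h; rewrite -ltr_ln ?posrE ?exprn_gt0// lnXn// -mulr_natl.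
by move: h; rewrite lnV ?posrE// mulrN ltrN2.
Qed.

(** The index [K] is taken just above [(ln D + ln eps^-1) / ln q^-1]. The factor [h ^ K] then yields
    the rate [ln h / ln q^-1], while the polynomial factor costs only [delta]. *)
Lemma net_growth_rate (R : realType) (D q h delta : R) :
  0 < D -> 0 < q < 1 -> 1 <= h -> 0 < delta ->
  exists2 e : R, 0 < e & forall eps, 0 < eps -> eps < e ->
    0 < ln eps^-1 /\ exists K : nat, D * q ^+ K < eps /\
      ln (K.+1%:R ^+ 2 * h ^+ K) <= (ln h / ln q^-1 + delta) * ln eps^-1.
Proof.
move=> D0 /andP[q0 q1] h1 delta0; set l := ln q^-1.
have l0 : 0 < l by rewrite ln_gt0// invf_gt1.
have lh0 : 0 <= ln h by exact: ln_ge0.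
have h0 : 0 < h by exact: lt_le_trans h1.
(* From [ln (b * (K + 1)) <= b * (K + 1)] the polynomial factor contributes slope
   [2 * b / l = delta / 2]. The constant [C] gathers the terms free of [eps], absorbed by the other
   [delta / 2]. *)
pose b := delta * l / 4.
have b0 : 0 < b by rewrite divr_gt0// mulr_gt0.
pose C := (2 * b + ln h) * (ln D / l + 1) + 2 * b - 2 * ln b.
(* The first bound makes [ln D + ln eps^-1] nonnegative; the second makes [ln eps^-1] large enough
   to absorb [C]. *)
exists (Num.min D (expR (- (2 * `|C| / delta + 1)))).
  by rewrite lt_min D0 expR_gt0.
move=> eps eps0; rewrite lt_min => /andP[epsD epsC].
set L := ln eps^-1.
have CL : 2 * `|C| / delta + 1 < L.
  by rewrite /L lnV ?posrE// ltrNr -ltr_expR lnK.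
have C0 : 0 <= 2 * `|C| / delta by rewrite divr_ge0 ?mulr_ge0// ltW.
have L0 : 0 < L by lra.
split=> //.
have lDe0 : 0 <= ln D + L.
  by rewrite /L -lnM ?posrE ?invr_gt0// ln_ge0// ler_pdivlMr// mul1r ltW.
pose x := (ln D + L) / l.
have x0 : 0 <= x by rewrite divr_ge0// ltW.
have [xK Kx] : (x < (Num.trunc x).+1%:R) /\ (Num.trunc x).+1%:R <= x + 1.
  by have /andP[xa xb] := truncn_itv x0; rewrite xb -natr1 lerD2r.
exists (Num.trunc x).+1; move: (Num.trunc x).+1 xK Kx => K xK Kx; split.
  rewrite mulrC -ltr_pdivlMr//; apply: expr_lt_of_ln => //; first exact: divr_gt0.
  rewrite ln_div ?posrE// opprB -/l.
  by move: xK; rewrite /x ltr_pdivrMr// /L lnV ?posrE.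
rewrite lnM ?posrE ?exprn_gt0// !lnXn//.
have lnK1 : ln K.+1%:R <= b * (K%:R + 1) - ln b.
  have bK : 0 < b * (K%:R + 1) by rewrite mulr_gt0// ltr_wpDl.
  have := ln_sublinear bK; rewrite lnM ?posrE ?ltr_wpDl// natr1; lra.
have hK : ln h *+ K <= ln h * (x + 1) by rewrite -mulr_natr ler_wpM2l.
have bK : b * (K%:R + 1) <= b * (x + 2) by rewrite ler_wpM2l ?(ltW b0)//; lra.
have CL' : C <= delta / 2 * L.
  rewrite (le_trans (ler_norm _))//.
  have : 2 * `|C| / delta < L by lra.
  by rewrite ltr_pdivrMr//; lra.
rewrite -[ln _ *+ 2]mulr_natl.
apply: (@le_trans _ _ (C + (2 * b + ln h) * (L / l))).
  have -> : C + (2 * b + ln h) * (L / l) =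
      2 * (b * (x + 2) - ln b) + ln h * (x + 1).
    by rewrite /C /x; field; rewrite gt_eqF.
  by rewrite lerD// ler_wpM2l//; lra.
have -> : (ln h / l + delta) * L = delta / 2 * L + (2 * b + ln h) * (L / l).
  by rewrite /b; field; rewrite gt_eqF.
by rewrite lerD2r.
Qed.

Section Attractor.
Context (R : realType) (k : scalar_kind).

Lemma fractal_dim_le (X : normedModType (scalars R k)) (V G : set X) (D q h : R) :
  0 < D -> 0 < q < 1 -> 1 <= h ->
  (forall (K : nat) eps, D * q ^+ K < eps ->
     (covering_number V G eps <= (K.+1%:R ^+ 2 * h ^+ K)%:E)%E) ->
  (fractal_dim V G <= (ln h / ln q^-1)%:E)%E.
Proof.
move=> D0 q01 h1 cov; apply/lee_addgt0Pr => delta delta0.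
have [e e0 eP] := net_growth_rate D0 q01 h1 delta0.
have V0 : (0 : R)^'+ [set x | 0 < x < e].
  near=> x; apply/andP; split; near: x; first exact: nbhs_right_gt.
  exact: nbhs_right_lt.
apply: ge_ereal_inf => /=; eexists; first by exists [set x | 0 < x < e].
apply: ge_ereal_sup => _ [eps /= /andP[eps0 epse] <-].
have [L0 [K [DK lnK]]] := eP _ eps0 epse.
have h0 : 0 < h by exact: lt_le_trans h1.
have K0 : 0 < K.+1%:R ^+ 2 * h ^+ K by rewrite mulr_gt0// exprn_gt0.
have N0 : (0 <= covering_number V G eps)%E.
  by apply: le_ereal_inf_tmp => _ [s _ <-]; rewrite lee_fin ler0n.
rewrite -EFinD.
rewrite (@le_trans _ _
  ((ln (K.+1%:R ^+ 2 * h ^+ K))%:E * ((ln eps^-1)^-1)%:E)%E)//.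
  rewrite lee_wpmul2r ?lee_fin ?invr_ge0 ?(ltW L0)//.
  rewrite -lne_EFin// lee_lne ?in_itv/= ?leey ?andbT ?lee_fin ?(ltW K0)//.
  exact: cov.
by rewrite -EFinM lee_fin ler_pdivrMr.
Unshelve. all: by end_near. Qed.

Context (X : completeNormedModType (scalars R k)).

(** An ultrafilter on [A] contains one of the finitely many balls of each radius, hence is Cauchy.
    Completeness gives a limit, and closedness puts it in [A]. *)
Lemma compact_of_nets (A : set X) : closed A ->
  (forall e : R, 0 < e -> exists s : seq X,
     forall x, A x -> exists2 y, y \in s & rnorm (x - y) < e) -> compact A.
Proof.
move=> Acl Anet; rewrite compact_ultra => F FU FA.
have Fseq (s : seq X) (U : X -> set X) :
    F [set x | exists2 y, y \in s & U y x] -> exists y, F (U y).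
  elim: s => [|y s IHs] Fs.
    have [x [z]] := filter_ex Fs; by rewrite in_nil.
  have [Uy|nUy] := in_ultra_setVsetC (U y) FU; first by exists y.
  apply: IHs; apply: filterS (filterI Fs nUy) => x [[z + Uzx] nUyx].
  by rewrite inE => /predU1P[zy|zs]; [rewrite zy in Uzx|exists z].
have /cauchy_cvgP/cvg_ex[p Fp] : cauchy F.
  apply: cauchy_exP => e e0.
  have eE := ger0_real_scalar (ltW e0).
  have [|s As] := Anet (scalar_re e).
    by rewrite -(ltr_real_scalar k) -eE real_scalar0.
  apply: (Fseq s); apply: filterS FA => x /As[y ys xy].
  by exists y => //; rewrite eE; apply/ball_rnorm; rewrite rdistC.
exists p; split=> //; rewrite (closure_id A).1// => U /Fp FUp.
exact: filter_ex (filterI FA FUp).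
Qed.

End Attractor.

(** * The attracting set *)

Lemma ladyzhenskaya_sub (R : realType) (k : scalar_kind)
    (X : normedModType (scalars R k)) (S : R -> X -> X) (A B : set X) T n eta kappa
    (Xn : submodClosed X) (P : X -> subspace_type Xn) : A `<=` B ->
  ladyzhenskaya_type S B T n eta kappa P -> ladyzhenskaya_type S A T n eta kappa P.
Proof.
move=> AB [n0 Pn eta01 k0 LP]; split=> // x y Ax Ay.
exact: LP (AB _ Ax) (AB _ Ay).
Qed.

Lemma ladyzhenskaya_lipschitz (R : realType) (k : scalar_kind)
    (X : normedModType (scalars R k)) (S : R -> X -> X) (B : set X) T n eta kappa
    (Xn : submodClosed X) (P : X -> subspace_type Xn) :
  ladyzhenskaya_type S B T n eta kappa P ->
  forall x y, B x -> B y -> rnorm (S T x - S T y) <= (eta + kappa) * rnorm (x - y).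
Proof.
move=> [_ _ _ _ LP] x y Bx By; have [h1 h2] := LP x y Bx By.
rewrite (le_trans (ler_rdist_split (val (P (S T x))) (val (P (S T y))) _ _))//.
by rewrite mulrDl lerD.
Qed.

Lemma seq_dist_gt0 (R : realType) (k : scalar_kind)
    (X : normedModType (scalars R k)) (s : seq X) x : x \notin s ->
  exists2 e, 0 < e & forall y, y \in s -> e <= rnorm (x - y).
Proof.
elim: s => [|y s IHs]; first by exists 1.
rewrite inE negb_or => /andP[xy /IHs[e e0 es]].
exists (Num.min (rnorm (x - y)) e).
  by rewrite lt_min e0 andbT rnorm_gt0// subr_eq0.
move=> z; rewrite inE => /predU1P[->|/es ez]; first by rewrite ge_min lexx.
by rewrite ge_min ez orbT.
Qed.

Section AttractingSet.
Context (R : realType) (k : scalar_kind) (tk : time_kind).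
Context (X : completeNormedModType (scalars R k)) (V B0 B : set X) (S : R -> X -> X).
Context (T : R) (n : nat) (eta kappa sigma D : R).
Context (Xn : submodClosed X) (P : X -> subspace_type Xn).
Hypotheses (sgS : semigroup_on tk V S) (B0V : B0 `<=` V) (BB0 : B `<=` B0).
Hypotheses (Vcl : closed V) (TT : time_set tk T) (T0 : 0 < T).
Hypotheses (LS : ladyzhenskaya_type S B0 T n eta kappa P).
Hypotheses (sigma01 : 0 < sigma < 1 - eta) (SB : S T @` B `<=` B).
Hypotheses (D0 : 0 < D) (BD : diam_le B D) (Bn0 : B !=set0).
Hypotheses (ac : asymptotically_closed tk V S \/ closed B0).

Let q := eta + sigma.
Let h := (1 + 2 * kappa / sigma) ^+ real_dim k n.

Let sigma0 : 0 < sigma. Proof. by case/andP: sigma01. Qed.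
Let LSB : ladyzhenskaya_type S B T n eta kappa P.
Proof. exact: ladyzhenskaya_sub LS. Qed.
Let BV : B `<=` V. Proof. exact: subset_trans B0V. Qed.
Let h1 : 1 <= h. Proof. exact: growth_ge1 LSB sigma0. Qed.
Let q01 : 0 < q < 1.
Proof.
have [_ _ /andP[eta0 _] _ _] := LS; case/andP: sigma01 => _ s1.
by rewrite /q ltr_wpDl//= addrC -ltrBrDr.
Qed.

(** * Forward orbits of the nets and their closure *)

Section Nets.
Variable E : nat -> seq X.
Hypothesis E_size : forall j, (size (E j))%:R <= h ^+ j.
Hypothesis E_sub : forall j x, x \in E j -> (S (j%:R * T) @` B) x.
Hypothesis E_net : forall j x, (S (j%:R * T) @` B) x ->
  exists2 y, y \in E j & rnorm (x - y) <= D * q ^+ j.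

(** Level [j] collects the images of [E i] under [S T] applied [j - i] times, for all [i <= j]; it
    therefore lies in the image of [B] at time [j * T]. *)
Fixpoint orbit_nets j : seq X :=
  if j is i.+1 then E j ++ map (S T) (orbit_nets i) else E 0%N.
Local Notation F := orbit_nets.

Let U := [set x | exists j, x \in F j].

Lemma sub_orbit_nets j x : x \in E j -> x \in F j.
Proof. by case: j => //= j xE; rewrite mem_cat xE. Qed.

Lemma orbit_netsS j x : x \in F j -> S T x \in F j.+1.
Proof. by move=> xF; rewrite /= mem_cat map_f ?orbT. Qed.

Lemma orbit_nets_orbit j x : x \in F j -> (S (j%:R * T) @` B) x.
Proof.
elim: j x => [|j IHj] x /=; first exact: E_sub.
rewrite mem_cat => /orP[/E_sub//|/mapP[y /IHj[z Bz <-] ->]].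
by exists z => //; rewrite (semigroupS sgS BV TT).
Qed.

Lemma size_orbit_nets j : (size (F j))%:R <= j.+1%:R * h ^+ j.
Proof.
elim: j => [|j IHj]; first by rewrite mul1r /= E_size.
rewrite /= size_cat size_map natrD -[X in _ <= X * _]natr1 mulrDl mul1r addrC.
rewrite lerD ?E_size// (le_trans IHj)// ler_wpM2l// exprS.
by rewrite ler_peMl// exprn_ge0// (le_trans _ h1).
Qed.

Let FB j x : x \in F j -> B x.
Proof. by move=> /orbit_nets_orbit /(semigroup_iter_sub sgS BV TT SB). Qed.

(** Levels from [K] on lie in the image of [B] at time [K * T], where [E K] is a net; the finitely
    many points of earlier levels serve as their own centres. The count [(1 + K ^ 2) * h ^ K]
    explains the factor [K.+1 ^ 2]. *)
Lemma orbit_nets_net K : exists s : seq X,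
  [/\ (size s)%:R <= K.+1%:R ^+ 2 * h ^+ K, forall x, x \in s -> U x
    & forall x, U x -> exists2 y, y \in s & rnorm (x - y) <= D * q ^+ K].
Proof.
have q0 : 0 <= q by case/andP: q01 => /ltW.
have hX0 j : 0 <= h ^+ j by rewrite exprn_ge0 ?(le_trans _ h1).
pose s := flatten [seq F j | j <- iota 0 K]; exists (E K ++ s); split.
- have s_size L : (L <= K)%N ->
      (size (flatten [seq F j | j <- iota 0 L]))%:R <= L%:R * (K%:R * h ^+ K).
    elim: L => [|L IHL] LK; first by rewrite mul0r.
    rewrite -addn1 iotaD map_cat flatten_cat size_cat/= cats0 !natrD mulrDl mul1r.
    rewrite lerD ?IHL ?(ltnW LK)// (le_trans (size_orbit_nets L))//.
    have hLK : h ^+ L <= h ^+ K by apply: ler_weXn2l => //; exact: ltnW.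
    by rewrite ler_pM ?hX0 ?ler_nat.
  rewrite size_cat natrD (le_trans (lerD (E_size K) (s_size K (leqnn K))))//.
  rewrite mulrA -{1}[h ^+ K]mul1r -mulrDl ler_wpM2r ?hX0//.
  rewrite -natr1 sqrrD expr1n mulr1 expr2 addrC lerD2r lerDl.
  by rewrite mulrn_wge0.
- move=> x; rewrite mem_cat => /orP[xE|/flatten_mapP[j _ xj]]; last by exists j.
  by exists K; exact: sub_orbit_nets.
- move=> x [j xj]; have [jK|Kj] := ltnP j K.
    exists x; last by rewrite subrr rnorm0 mulr_ge0 ?exprn_ge0// ltW.
    by rewrite mem_cat; apply/orP; right; apply/flatten_mapP; exists j; rewrite ?mem_iota.
  have [z Bz zx] := orbit_nets_orbit xj.
  have [|y yE xy] := @E_net K x; last by exists y; rewrite // mem_cat yE.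
  exists (S ((j - K)%:R * T) z).
    by apply: (semigroup_iter_sub sgS BV TT SB (j := j - K)); exists z.
  have [_ _ SD] := sgS; rewrite SD; [|exact: time_setMn|exact: time_setMn|exact: BV].
  by rewrite -mulrDl -natrD subnKC.
Qed.

Lemma closure_orbit_nets_sub : closure U `<=` V.
Proof.
rewrite [V in _ `<=` V](closure_id V).1//; apply: closureS => x [j /FB].
exact: BV.
Qed.

Lemma closure_orbit_nets_net K eps : D * q ^+ K < eps -> exists s : seq X,
  [/\ (size s)%:R <= K.+1%:R ^+ 2 * h ^+ K, forall x, x \in s -> closure U x
    & forall x, closure U x -> exists2 y, y \in s & rnorm (x - y) < eps].
Proof.
move=> Deps; have [s [sK sU sD]] := orbit_nets_net K; exists s; split=> //.
  by move=> x /sU; exact: subset_closure.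
move=> x /closure_rnorm/(_ (eps - D * q ^+ K)); rewrite subr_gt0 => /(_ Deps).
move=> [u /sD[y ys uy] xu]; exists y => //.
by rewrite (le_lt_trans (ler_rdistD u _ _))//; move: uy xu; lra.
Qed.

Lemma closure_orbit_nets_compact : compact (closure U).
Proof.
apply: compact_of_nets => [|e e0]; first exact: closed_closure.
have /andP[q0 q1] := q01.
(* An index with [D * q ^ K] small comes from [net_growth_rate] with growth factor 1, at a scale
   below both [e] and its threshold [e1]. *)
have [K DK] : exists K, D * q ^+ K < e.
  have [e1 e10 eP] := net_growth_rate D0 q01 (lexx 1) (ltr01 : 0 < 1 :> R).
  have m0 : 0 < Num.min e (e1 / 2) by rewrite lt_min e0 divr_gt0.
  have [||_ [K [DK _]]] := eP (Num.min e (e1 / 2)) => //.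
    by rewrite gt_min; apply/orP; right; lra.
  by exists K; rewrite (lt_le_trans DK)// ge_min lexx.
by have [s [_ _ sP]] := closure_orbit_nets_net DK; exists s.
Qed.

Lemma closure_orbit_nets_dim : (fractal_dim V (closure U) <= (ln h / ln q^-1)%:E)%E.
Proof.
apply: (fractal_dim_le D0) => // K eps DK.
have [s [sK sU sP]] := closure_orbit_nets_net DK.
apply: le_trans (covering_number_le closure_orbit_nets_sub sU sP) _.
by rewrite lee_fin.
Qed.

(* A point of the closure outside [U] is a limit of points [u i = S (t i) (b i)]
   with [t i] tending to infinity, as every [F j] is finite. *)
Lemma closure_orbit_nets_seq x : closure U x -> ~ U x ->
  exists (u : nat -> X) (j : nat -> nat),
    [/\ forall i, u i \in F (j i), forall i, (i <= j i)%N
      & forall i, rnorm (x - u i) < i.+1%:R^-1].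
Proof.
move=> xU nUx.
suff /choice[uj ujP] : forall i, exists uj : X * nat,
    [/\ uj.1 \in F uj.2, (i <= uj.2)%N & rnorm (x - uj.1) < i.+1%:R^-1].
  exists (fun i => (uj i).1), (fun i => (uj i).2).
  by split=> i; have [] := ujP i.
move=> i; have /seq_dist_gt0[e e0 eP] : x \notin flatten [seq F j | j <- iota 0 i].
  by apply/negP => /flatten_mapP[j _ xj]; apply: nUx; exists j.
have [|u [j uj] xu] := (closure_rnorm U x).1 xU (Num.min e i.+1%:R^-1).
  by rewrite lt_min e0 invr_gt0 ltr0n.
exists (u, j); move: xu; rewrite lt_min => /andP[xue xui]; split=> //=.
rewrite leqNgt; apply/negP => ji; move: xue; rewrite ltNge eP//.
by apply/flatten_mapP; exists j; rewrite ?mem_iota.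
Qed.

(** Orbit points stay orbit points. Any other [x] is a limit of late orbit points [u i]; the
    Lipschitz bound on [B0] makes [S T (u i)] Cauchy, with limit [y] in the closure. It remains to
    identify [S T x] with [y]. *)
Lemma closure_orbit_nets_invariant : S T @` closure U `<=` closure U.
Proof.
move=> _ [x xU <-]; have [[j xj]|nUx] := pselect (U x).
  by apply: subset_closure; exists j.+1; exact: orbit_netsS.
have [u [j [uj ij xu]]] := closure_orbit_nets_seq xU nUx.
have L0 : 0 < eta + kappa by have [_ _ /andP[? _] ? _] := LS; rewrite ltr_wpDl.
have ui_small e : 0 < e -> exists N, forall i, (N <= i)%N -> rnorm (x - u i) < e.
  move=> e0; exists (Num.trunc e^-1) => i Ni; apply: (lt_le_trans (xu i)).
  rewrite -[leRHS]invrK lef_pV2 ?posrE ?invr_gt0 ?ltr0n//.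
  by rewrite (le_trans (ltW (truncnS_gt _)))// ler_nat ltnS.
have uB0 i : B0 (u i) by exact/BB0/FB/uj.
have [y Suy] : exists y : X, S T (u i) @[i --> \oo] --> y.
  apply: cauchy_seq_cvg => e e0.
  have [|N Nu] := ui_small (e / (2 * (eta + kappa))).
    by rewrite divr_gt0// mulr_gt0.
  exists N => a b Na Nb.
  apply: (le_lt_trans (ladyzhenskaya_lipschitz LS (uB0 a) (uB0 b))).
  rewrite mulrC -ltr_pdivlMr// (le_lt_trans (ler_rdistD x _ _))// rdistC.
  rewrite (lt_le_trans (ltrD (Nu a Na) (Nu b Nb)))//.
  by rewrite invfM mulrA -mulrDl -splitr.
have yU : closure U y.
  apply/closure_rnorm => e e0; have [N Ny] := (cvgn_rnorm _ _).1 Suy e e0.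
  by exists (S T (u N)); [exists (j N).+1; exact: orbit_netsS|exact: Ny].
suff -> : S T x = y by [].
have ux : u i @[i --> \oo] --> x by exact/cvgn_rnorm.
(* If [B0] is closed it contains [x], and the Lipschitz bound applies at [x] itself. Otherwise [u i]
   is written as the image of a point of the bounded set [B] at time [j i * T], which tends to
   infinity, and asymptotic closedness applies. *)
case: ac => [ac'|B0cl]; last first.
  apply: (@cvg_unique _ (@norm_hausdorff _ X) (S T (u i) @[i --> \oo])) => //.
  apply/cvgn_rnorm => e e0; have [|N Nu] := ui_small (e / (eta + kappa)).
    exact: divr_gt0.
  have B0x : B0 x.
    rewrite (closure_id B0).1//; apply: closureS xU => z [i zi].
    exact/BB0/FB/zi.
  exists N => i Ni; apply: (le_lt_trans (ladyzhenskaya_lipschitz LS B0x (uB0 i))).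
  by rewrite mulrC -ltr_pdivlMr// Nu.
have /choice[b bP] : forall i, exists b, B b /\ S ((j i)%:R * T) b = u i.
  by move=> i; have [z Bz zu] := orbit_nets_orbit (uj i); exists z.
have [_ _ SD] := sgS.
apply: (ac' T (fun i => (j i)%:R * T) b) => //.
- by move=> i; exact: time_setMn.
- apply/cvgryPge => A; near=> i.
  rewrite -ler_pdivrMr// (le_trans (y := i%:R))//; last by rewrite ler_nat.
  by near: i; exact: nbhs_infty_ger.
- by move=> i; apply: BV; have [] := bP i.
- have [b0 Bb0] := Bn0; apply/bounded_setP; exists (D + rnorm b0) => _ [i _ <-].
  rewrite -[b i](subrK b0) (le_trans (ler_rnormD _ _))// lerD2r.
  by apply: BD => //; have [] := bP i.
- exact: closure_orbit_nets_sub.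
- exact: closure_orbit_nets_sub.
- suff -> : (fun i => S ((j i)%:R * T) (b i)) = u by [].
  by apply/funext => i; have [] := bP i.
- suff -> : (fun i => S (T + (j i)%:R * T) (b i)) = (fun i => S T (u i)) by [].
  apply/funext => i; have [Bb <-] := bP i.
  by rewrite SD//; [exact: time_setMn|exact: BV].
Unshelve. all: by end_near. Qed.

End Nets.

(** Here [B0] stands for the absorbing set, which carries the Ladyzhenskaya estimates and possibly
    closedness, and [B] for its positively invariant part, in which the nets are chosen. *)
Lemma exists_attracting_set : exists M0 : set X,
  [/\ M0 !=set0, compact M0 /\ M0 `<=` V, S T @` M0 `<=` M0,
      (fractal_dim V M0 <= (ln h / ln q^-1)%:E)%E
    & forall j x, (S (j%:R * T) @` B) x ->
        exists2 y, M0 y & rnorm (x - y) <= D * q ^+ j].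
Proof.
have /choice[E EP] j := semigroup_iter_net sgS BV TT LSB sigma0 SB j D0 BD.
have E_size j : (size (E j))%:R <= h ^+ j by have [] := EP j.
have E_sub j x : x \in E j -> (S (j%:R * T) @` B) x by have [_ h2 _] := EP j; exact: h2.
have E_net j x : (S (j%:R * T) @` B) x ->
  exists2 y, y \in E j & rnorm (x - y) <= D * q ^+ j by have [_ _ h3] := EP j; exact: h3.
exists (closure [set x | exists j, x \in orbit_nets E j]); split.
- have [b Bb] := Bn0; have [|y yE _] := @E_net 0%N (S (0%:R * T) b); first by exists b.
  by exists y; apply: subset_closure; exists 0%N.
- split; first exact: closure_orbit_nets_compact.
  exact: closure_orbit_nets_sub.
- exact: closure_orbit_nets_invariant.
- exact: closure_orbit_nets_dim.
- move=> j x /E_net[y yE xy]; exists y => //.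
  by apply: subset_closure; exists j; exact: sub_orbit_nets.
Qed.

End AttractingSet.

(** * Exponential attraction *)

Lemma semidist_ge0 (R : realType) (k : scalar_kind)
    (X : normedModType (scalars R k)) (A M : set X) : (0 <= semidist A M)%E.
Proof. by apply: ereal_sup_ubound; left. Qed.

Lemma semidist_le (R : realType) (k : scalar_kind)
    (X : normedModType (scalars R k)) (A M : set X) r : 0 <= r ->
  (forall x, A x -> exists2 y, M y & rnorm (x - y) <= r) ->
  (semidist A M <= r%:E)%E.
Proof.
move=> r0 AM; apply: ge_ereal_sup => _ [->|[x /AM[y My xy] <-]] //.
apply: ge_ereal_inf; exists (rnorm (x - y))%:E; first by exists y.
by rewrite lee_fin.
Qed.

(** A bounded set enters [B0] by time [tG] and [B] after [k1] more steps; each further step of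
    length [T] shrinks the distance bound to [M] by the factor [q]. *)
Lemma exponential_attraction (R : realType) (k : scalar_kind) (tk : time_kind)
    (X : normedModType (scalars R k)) (V B0 B M : set X) (S : R -> X -> X)
    (T D q : R) (k1 : nat) :
  semigroup_on tk V S -> absorbing_set tk V S B0 -> time_set tk T -> 0 < T ->
  0 < D -> 0 < q < 1 -> S (k1%:R * T) @` B0 `<=` B -> B `<=` V ->
  (forall j x, (S (j%:R * T) @` B) x ->
     exists2 y, M y & rnorm (x - y) <= D * q ^+ j) ->
  exists2 xi : R, 0 < xi & forall G, G `<=` V -> bounded_set G ->
    ((expR (xi * t))%:E * semidist (S t @` G) M)%E
      @[t --> within (time_set tk) (pinfty_nbhs R)] --> 0%E.
Proof.
move=> [SV S0 SD] [B0V B0abs] TT T0 D0 /andP[q0 q1] SB0 BV BM.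
set l := ln q^-1; have l0 : 0 < l by rewrite ln_gt0// invf_gt1.
(* Half of the decay rate [l / T]: after multiplication by [expR (xi * t)] a factor
   [expR (- (xi * t))] is left over. *)
pose xi := l / (2 * T); have xi0 : 0 < xi by rewrite divr_gt0// mulr_gt0.
exists xi => // G GV /(B0abs G GV)[tG TtG tGB0].
(* The summand 1 in the exponent of [C] compensates for rounding the number of steps down. *)
pose t1 := tG + k1%:R * T; pose C := D * expR (l * (t1 / T + 1)).
have C0 : 0 < C by rewrite mulr_gt0// expR_gt0.
have semidistC t : time_set tk t -> t1 <= t ->
    (semidist (S t @` G) M <= (C * expR (- (2 * xi * t)))%:E)%E.
  move=> Tt t1t; have x0 : 0 <= (t - t1) / T by rewrite divr_ge0 ?subr_ge0// ltW.
  pose j := Num.trunc ((t - t1) / T).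
  have /andP[jt tj] := truncn_itv x0.
  apply: (@le_trans _ _ (D * q ^+ j)%:E).
    apply: semidist_le => [|_ [x Gx <-]]; first by rewrite mulr_ge0 ?exprn_ge0 ?ltW.
    apply: BM; pose s := t - (j%:R * T + k1%:R * T).
    have Ts' : time_set tk (j%:R * T + k1%:R * T).
      by apply: time_setD; exact: time_setMn.
    have tGs : tG <= s.
      by move: jt; rewrite ler_pdivlMr// /s /t1 -/j; lra.
    have Ts : time_set tk s.
      apply: time_setB => //; move: tGs (time_set_ge0 TtG); rewrite /s; lra.
    have Bs : B0 (S s x) by apply: (tGB0 s) => //; exists x.
    exists (S (k1%:R * T) (S s x)); first by apply: SB0; exists (S s x).
    rewrite !SD//; do ?[exact: time_setMn|exact: B0V|exact: GV].
      by congr (S _ _); rewrite /s; ring.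
  rewrite lee_fin /C -mulrA ler_pM2l// -expRD -[q]lnK ?posrE// -expRM_natl ler_expR.
  have -> : ln q = - l by rewrite /l lnV ?posrE// opprK.
  rewrite mulrN lerNl -/j.
  have -> : - (l * (t1 / T + 1) - 2 * xi * t) = l * ((t - t1) / T - 1).
    by rewrite /xi; field; rewrite gt_eqF.
  by rewrite mulrC ler_pM2r// lerBlDr natr1 ltW.
apply: (@squeeze_cvge _ _ _ _ (cst 0%E) _ (fun t => (C * expR (- (xi * t)))%:E)).
- have : \forall t \near +oo, t1 <= t by apply: nbhs_pinfty_ge; exact: num_real.
  apply: filterS => t t1t Tt; apply/andP; split.
    by rewrite mule_ge0 ?semidist_ge0// lee_fin expR_ge0.
  apply: (@le_trans _ _ ((expR (xi * t))%:E * (C * expR (- (2 * xi * t)))%:E)%E).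
    by rewrite lee_wpmul2l ?lee_fin ?expR_ge0// semidistC.
  rewrite -EFinM lee_fin mulrCA -expRD ler_pM2l// ler_expR.
  by rewrite le_eqVlt; apply/orP; left; apply/eqP; ring.
- exact: cvg_cst.
- apply: cvg_within_filter; apply/cvg_EFin; first by near=> t.
  rewrite -(mulr0 C); apply: cvgM; first exact: cvg_cst.
  apply: (cvg_comp _ _ _ (@cvgr_expR R)).
  by apply: gt0_cvgMry => //; exact: cvg_id.
Unshelve. all: by end_near. Qed.

(** * Smoothing, squeezing and covering; the exponential attractor *)

Theorem proposition7p3 (R : realType) (k : scalar_kind) (tk : time_kind) :
  (forall (X : normedModType (scalars R k)) (V : set X) (S : R -> X -> X)
      (B : set X) (T : R) (n : nat) (eta kappa : R)
      (Xn : submodClosed X) (P : X -> subspace_type Xn),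
    V !=set0 -> semigroup_on tk V S ->
    B `<=` V -> time_set tk T -> 0 < T ->
    ladyzhenskaya_type S B T n eta kappa P ->
    [/\ smoothing_property S B T eta kappa (subspace_incl Xn)
          (fun x => S T x - val (P (S T x))) (fun x => P (S T x)),
        generalized_squeezing S B T n eta 1 kappa
      & B !=set0 -> bounded_set B -> S T @` B `<=` B ->
        forall sigma : R, 0 < sigma < 1 - eta ->
        exists (k0 : nat) (a b h : R),
          [/\ (0 < k0)%N, 0 < a /\ 0 < b, 1 <= h,
              forall j : nat, (k0 <= j)%N ->
                (covering_number V (S (j%:R * T)%R @` B)
                   (a * (eta + sigma) ^+ j)%R <= (b * h ^+ j)%:E)%E
            & h <= (1 + 2 * kappa * dBM_l2 (subspace_type Xn) n / sigma)
                     ^+ real_dim k n]])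
  /\
  (forall (X : completeNormedModType (scalars R k)) (V : set X)
      (S : R -> X -> X) (B : set X) (T : R) (n : nat) (eta kappa : R)
      (Xn : submodClosed X) (P : X -> subspace_type Xn),
    V !=set0 -> closed V -> semigroup_on tk V S ->
    absorbing_set tk V S B -> bounded_set B ->
    time_set tk T -> 0 < T ->
    ladyzhenskaya_type S B T n eta kappa P ->
    asymptotically_closed tk V S \/ closed B ->
    forall sigma : R, 0 < sigma < 1 - eta ->
    exists M0 : set X,
      discrete_exponential_attractor tk V S T M0 /\
      (fractal_dim V M0 <=
        ((real_dim k n)%:R *
         (ln (1 + 2 * kappa * dBM_l2 (subspace_type Xn) n / sigma)
          / ln (eta + sigma)^-1))%:E)%E).
Proof.
split=> [X V S B T n eta kappa Xn P _ sgS BV TT T0 LS|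
         X V S B T n eta kappa Xn P Vn0 Vcl sgS Babs Bbd TT T0 LS ac sigma sigma01].
- have [n0 Pn eta01 k0 LP] := LS; split.
  + split=> //; first exact: subspace_compact_embedding Pn.
    by move=> x Bx; rewrite /= subrK.
  + exists (subspace_type Xn), P; split=> // x y Bx By.
    have [h1 h2] := LP x y Bx By; rewrite -(rnorm_val (P _ - P _)) raddfB; split=> //.
    rewrite (le_trans (ler_rdist_split (val (P (S T x))) (val (P (S T y))) _ _))//.
    by rewrite mul1r lerD.
  + move=> _ /bounded_diam_le[D D0 BD] SB sigma /andP[sigma0 sigma1].
    have q0 : 0 < eta + sigma by case/andP: eta01 => ? _; rewrite ltr_wpDl.
    (* The factor 2 in [a] turns the non-strict distance bound [D * (eta + sigma) ^ j] into the open
       balls of the covering number. *)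
    exists 1%N, (2 * D), 1, ((1 + 2 * kappa / sigma) ^+ real_dim k n); split=> //.
    * by split; rewrite ?mulr_gt0.
    * exact: growth_ge1 LS sigma0.
    * move=> j _; rewrite mul1r.
      have [s [sh sB sD]] := semigroup_iter_net sgS BV TT LS sigma0 SB j D0 BD.
      apply: (@le_trans _ _ (size s)%:R%:E); last by rewrite lee_fin.
      apply: covering_number_le => // [x|x /sD[y ys xy]].
        by move=> /(semigroup_iter_sub sgS BV TT SB)/BV.
      exists y => //; apply: (le_lt_trans xy).
      by rewrite -mulrA mulr_natl mulr2n ltrDr mulr_gt0// exprn_gt0.
    * rewrite lerXn2r ?nnegrE//.
      - by rewrite addr_ge0// divr_ge0 ?mulr_ge0// ltW.
      - rewrite (le_trans _ (growth_le_dBM n0 Pn k0 sigma0))//.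
        by rewrite addr_ge0// divr_ge0 ?mulr_ge0// ltW.
      - exact: growth_le_dBM.
have [n0 Pn /andP[eta0 eta1] k0 LP] := LS.
case/andP: (sigma01) => sigma0 sigma1.
have q01 : 0 < eta + sigma < 1 by rewrite ltr_wpDl//= addrC -ltrBrDr.
have [BV Babs'] := Babs.
have [tB TtB SBB] := Babs' B BV Bbd.
pose k1 := (Num.trunc (tB / T)).+1.
have k1B j : (k1 <= j)%N -> S (j%:R * T) @` B `<=` B.
  move=> k1j; apply: SBB; first exact: time_setMn.
  rewrite -ler_pdivrMr// (le_trans (ltW (truncnS_gt _)))//.
  by rewrite ler_nat.
(* The absorbing set need not be mapped into itself by [S T]. The choice of [k1] gives
   [k1 * T >= tB], so all these later images lie in [B]. *)
pose B1 := [set y | exists2 j, (k1 <= j)%N & (S (j%:R * T) @` B) y].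
have B1B : B1 `<=` B by move=> y [j /k1B]; exact.
have SB1 : S T @` B1 `<=` B1.
  move=> _ [_ [j k1j [x Bx <-]] <-]; exists j.+1; first exact: leqW.
  by exists x; rewrite // (semigroupS sgS BV TT).
(* Absorbing the singleton of a point of [V] shows that [B] is nonempty, and hence [B1]. *)
have B1n0 : B1 !=set0.
  have [v Vv] := Vn0.
  have [||tv Ttv tvB] := Babs' [set v].
  - by move=> _ ->.
  - by apply/bounded_setP; exists (rnorm v) => _ ->.
  have Bv : B (S tv v) by apply: (tvB tv) => //; exists v.
  by exists (S (k1%:R * T) (S tv v)), k1 => //; exists (S tv v).
have [D D0 BD] := bounded_diam_le Bbd.
have B1D : diam_le B1 D by move=> x y /B1B Bx /B1B By; exact: BD.
have [M0 [M0n0 [M0cpt M0V] SM0 M0dim M0att]] :=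
  exists_attracting_set sgS BV B1B Vcl TT T0 LS sigma01 SB1 D0 B1D B1n0 ac.
have M0dim' : (fractal_dim V M0 <=
    ((real_dim k n)%:R *
     (ln (1 + 2 * kappa * dBM_l2 (subspace_type Xn) n / sigma)
      / ln (eta + sigma)^-1))%:E)%E.
  apply: (le_trans M0dim); rewrite lee_fin.
  have h0 : 0 < 1 + 2 * kappa / sigma by rewrite addr_gt0// divr_gt0// mulr_gt0.
  rewrite lnXn// -[ln _ *+ _]mulr_natl -mulrA ler_wpM2l//; apply: ler_wpM2r.
    by rewrite invr_ge0 ltW// ln_gt0// invf_gt1//; case/andP: q01.
  have hd := growth_le_dBM n0 Pn k0 sigma0.
  by rewrite ler_ln ?posrE// (lt_le_trans h0).
exists M0; split=> //; split=> //; first exact: le_lt_trans M0dim' (ltry _).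
apply: (exponential_attraction sgS Babs TT T0 D0 q01 _ _ M0att (k1 := k1)).
  by move=> _ [x Bx <-]; exists k1 => //; exists x.
by move=> x /B1B /BV.
Qed.
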